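(* Let $A$ be a finite-dimensional unital $\mathbb C$-algebra of dimension $n$, let $\rho$ be a natural number, and let $f:\mathbb C\langle x_1,\ldots,x_\rho\rangle\{t\}\to A((t))$ be a unital homomorphism of $\mathbb C\{t\}$-algebras such that (1) $f(x_i)\in A[t,t^{-1}]$ for every $i$; (2) there are $c_1,\ldots,c_n\in\mathbb C\langle x_1,\ldots,x_\rho\rangle$ such that $f(c_1),\ldots,f(c_n)$ are linearly independent over $\mathbb C\{t\}$; (3) there is a natural number $\gamma$ with $\operatorname{Im}(f)\subseteq t^{-\gamma}A\{t\}$. Then there exist $q_1,\ldots,q_n\in\mathbb C\langle x_1,\ldots,x_\rho\rangle[t]$ such that $$\operatorname{Im}(f)=\sum_{i=1}^n f(q_i)\,\mathbb C\{t\},$$ and the elements $f(q_i)$ are linearly independent over $\mathbb C\{t\}$. Moreover, for all $1\le k,m\le n$ one has $$f(q_k)f(q_m)=\sum_{i=1}^n\bigl(\zeta_{i,k,m}+t\xi_{i,k,m}(t)\bigr)f(q_i)$$ with $\zeta_{i,k,m}\in\mathbb C$ and $\xi_{i,k,m}(t)\in\mathbb C\{t\}$. These constants define a finite-dimensional algebra $N$ with basis $d_1,\ldots,d_n$ over $\mathbb C$ by $$d_kd_m=\sum_{i=1}^n\zeta_{i,k,m}d_i,$$ and a formal deformation $\mathcal N$ over $\mathbb C\{t\}$ (with $\mathbb C\{t\}$-basis $d_1,\ldots,d_n$) by $$d_k\ast_t d_m=\sum_{i=1}^n\bigl(\zeta_{i,k,m}+t\xi_{i,k,m}(t)\bigr)d_i.$$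 Then $N\cong\operatorname{Im}(f)/t\cdot\operatorname{Im}(f)$, and the $\mathbb C\{t\}$-algebra $\mathcal N\cong\operatorname{Im}(f)$ is a flat deformation from $N$ to $A$.
   Context: All algebras are associative and unital (usually noncommutative) and all algebra homomorphisms are unital. $\mathbb C\{t\}$ denotes the ring of formal power series in $t$ over $\mathbb C$ (no convergence assumed). $\mathbb C\langle x_1,\ldots,x_\rho\rangle\{t\}$ denotes the free unital associative $\mathbb C\{t\}$-algebra on $x_1,\ldots,x_\rho$ (finite $\mathbb C\{t\}$-linear combinations of words); it contains the free $\mathbb C$-algebra $\mathbb C\langle x_1,\ldots,x_\rho\rangle$ and the polynomial ring $\mathbb C\langle x_1,\ldots,x_\rho\rangle[t]$ over it in the central variable $t$. For a finite-dimensional $\mathbb C$-algebra $A$, $A\{t\}$, $A((t))$ and $A[t,t^{-1}]$ denote respectively the power series, Laurent series and Laurent polynomials in the central variable $t$ with coefficients in $A$. A formal deformation of a $\mathbb C$-algebra $(N,\cdot,+)$ is an associative $\mathbb C\{t\}$-bilinear multiplication $\circ$ on the $\mathbb C\{t\}$-module $N\{t\}$ such that $(N\{t\},\circ,+)/t(N\{t\},\circ,+)\cong(N,\cdot,+)$ as a $\mathbb C$-algebra. If $d_1,\ldots,d_n$ is a basis of $N$, then $N\{t\}$ is identified with $\bigoplus_{i=1}^n\mathbb C\{t\}d_i$, and a multiplication is specified by its values on the basis elements. A deformation of a unital $\mathbb C$-algebra $N$ over $\mathbb C\{t\}$ is a $\mathbb C\{t\}$-algebra $\mathcal N$ which is a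 free $\mathbb C\{t\}$-module and such that $\mathcal N/t\mathcal N$ is isomorphic to $N$; it is assumed that the image of the identity element of $N$ is the identity element of $\mathcal N$. A flat deformation from $N$ to a unital algebra $A$ (over $\mathbb C\{t\}$) is such a deformation $\mathcal N$ for which $\mathcal N\otimes_{\mathbb C\{t\}}\mathbb C\{\{t\}\}$ is isomorphic to $A\otimes_{\mathbb C}\mathbb C\{\{t\}\}$, where $\mathbb C\{\{t\}\}$ denotes the algebraic closure of the fraction field of $\mathbb C\{t\}$. *)

(* Defs.v *)
From HB Require Import structures.
From mathcomp Require Import all_boot all_order all_algebra all_field.
From mathcomp Require Import boolp reals complex.
From mathcomp Require Import monalg.

Set Implicit Arguments.
Unset Strict Implicit.
Unset Printing Implicit Defensive.

Import Order.TTheory GRing.Theory Num.Theory.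
Local Open Scope ring_scope.
Local Open Scope quotient_scope.

Section Convolution.
Variables (U V W : zmodType) (op : U -> V -> W).

Definition conv (p : nat -> U) (q : nat -> V) (n : nat) : W :=
  \sum_(i < n.+1) op (p i) (q (n - i)%N).

Lemma conv_rev p q n : conv p q n = \sum_(i < n.+1) op (p (n - i)%N) (q i).
Proof.
rewrite /conv (reindex_inj rev_ord_inj) /=.
by apply: eq_bigr => j _; rewrite (sub_ordK j).
Qed.

Lemma eq_conv p p' q q' : p =1 p' -> q =1 q' -> conv p q =1 conv p' q'.
Proof. by move=> ep eq n; apply: eq_bigr => i _; rewrite ep eq. Qed.

Lemma convDl p p' q n : (forall v, {morph op^~ v : x y / x + y}) ->
  conv (fun i => p i + p' i) q n = conv p q n + conv p' q n.
Proof. by move=> D; rewrite -big_split; apply: eq_bigr => i _; rewrite D. Qed.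

Lemma convDr p q q' n : (forall u, {morph op u : x y / x + y}) ->
  conv p (fun i => q i + q' i) n = conv p q n + conv p q' n.
Proof. by move=> D; rewrite -big_split; apply: eq_bigr => i _; rewrite D. Qed.

Lemma conv_deltal u p q n : (forall v, op 0 v = 0) ->
  p =1 (fun i => if i == 0%N then u else 0) -> conv p q n = op u (q n).
Proof.
move=> op0 ep; rewrite /conv big_ord_recl ep subn0 /= big1 ?addr0 // => i _.
by rewrite ep op0.
Qed.

Lemma conv_deltar v p q n : (forall u, op u 0 = 0) ->
  q =1 (fun i => if i == 0%N then v else 0) -> conv p q n = op (p n) v.
Proof.
move=> op0 ep; rewrite conv_rev big_ord_recl ep subn0 /= big1 ?addr0 // => i _.
by rewrite ep op0.
Qed.

Lemma conv_vanl p q a n : (forall v, op 0 v = 0) -> (forall u, op u 0 = 0) ->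
  (forall i, (i < a)%N -> p i = 0) ->
  conv p q (n + a)%N = conv (fun i => p (i + a)%N) q n.
Proof.
move=> op0v opu0 p0; rewrite /conv -(big_mkord xpredT
  (fun i => op (p i) (q (n + a - i)%N))).
rewrite (big_cat_nat (n := a)) //=; last by rewrite -addSn leq_addl.
rewrite big_nat big1 ?add0r; last by move=> i /p0 ->.
rewrite -{1}[a]add0n big_addn -addSn addnK big_mkord.
by apply: eq_bigr => i _; rewrite subnDr.
Qed.

End Convolution.

Lemma convA (U V W UV VW X : zmodType) (f : U -> VW -> X) (g : V -> W -> VW)
    (f' : UV -> W -> X) (g' : U -> V -> UV)
    (fD : forall u, {morph f u : x y / x + y}) (f0 : forall u, f u 0 = 0)
    (f'D : forall w, {morph f'^~ w : x y / x + y}) (f'0 : forall w, f' 0 w = 0)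
    (fgA : forall u v w, f u (g v w) = f' (g' u v) w) p q r :
  conv f p (conv g q r) =1 conv f' (conv g' p q) r.
Proof.
move=> i; rewrite {1}/conv [RHS]conv_rev.
pose coef3 j k := f (p j) (g (q (i - j - k)%N) (r k)).
transitivity (\sum_(j < i.+1) \sum_(k < i.+1 | (k <= i - j)%N) coef3 j k).
  apply: eq_bigr => /= j _; rewrite conv_rev (big_morph _ (fD _) (f0 _)).
  by rewrite (big_ord_narrow_leq (leq_subr _ _)).
rewrite (exchange_big_dep predT) //=; apply: eq_bigr => k _.
transitivity (\sum_(j < i.+1 | (j <= i - k)%N) coef3 j k).
  apply: eq_bigl => j; rewrite -ltnS -(ltnS j) -!subSn ?leq_ord //.
  by rewrite -subn_gt0 -(subn_gt0 j) -!subnDA addnC.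
rewrite (big_ord_narrow_leq (leq_subr _ _)) /conv.
rewrite (big_morph (f'^~ _) (f'D _) (f'0 _)).
by apply: eq_bigr => j _; rewrite /coef3 -!subnDA addnC fgA.
Qed.

Record fps (T : Type) := Fps { fcoef : nat -> T }.
Arguments Fps {T} _.
Arguments fcoef {T} _ _.
Notation "{ 'fps' T }" := (fps T) (at level 0, format "{ 'fps'  T }").
Bind Scope ring_scope with fps.

HB.instance Definition _ T := gen_eqMixin {fps T}.
HB.instance Definition _ T := gen_choiceMixin {fps T}.

Lemma fpsP T (p q : {fps T}) : fcoef p =1 fcoef q <-> p = q.
Proof. by split=> [|-> //]; case: p q => p [q] /= /funext ->. Qed.

Section FpsZmod.
Variable V : zmodType.
Implicit Types p q r : {fps V}.

Definition fps0 : {fps V} := Fps (fun=> 0).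
Definition fps_opp p := Fps (fun i => - fcoef p i).
Definition fps_add p q := Fps (fun i => fcoef p i + fcoef q i).

Let addA : associative fps_add.
Proof. by move=> p q r; apply/fpsP => i /=; rewrite addrA. Qed.
Let addC : commutative fps_add.
Proof. by move=> p q; apply/fpsP => i /=; rewrite addrC. Qed.
Let add0 : left_id fps0 fps_add.
Proof. by move=> p; apply/fpsP => i /=; rewrite add0r. Qed.
Let addN : left_inverse fps0 fps_opp fps_add.
Proof. by move=> p; apply/fpsP => i /=; rewrite addNr. Qed.

HB.instance Definition _ := GRing.isZmodule.Build {fps V} addA addC add0 addN.

Lemma fcoef0 i : fcoef (0 : {fps V}) i = 0. Proof. by []. Qed.
Lemma fcoefN p i : fcoef (- p) i = - fcoef p i. Proof. by []. Qed.
Lemma fcoefD p q i : fcoef (p + q) i = fcoef p i + fcoef q i. Proof. by []. Qed.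
Lemma fcoefB p q i : fcoef (p - q) i = fcoef p i - fcoef q i. Proof. by []. Qed.

Definition fpsC (c : V) : {fps V} := Fps (fun i => if i == 0%N then c else 0).

Lemma fpsC_is_zmod_morphism : zmod_morphism fpsC.
Proof.
by move=> a b; apply/fpsP => i; rewrite fcoefB /=; case: ifP; rewrite ?subr0.
Qed.
HB.instance Definition _ :=
  GRing.isZmodMorphism.Build V {fps V} fpsC fpsC_is_zmod_morphism.

End FpsZmod.

Section FpsRing.
Variable R : nzRingType.
Implicit Types p q r : {fps R}.

Definition fps_mul p q : {fps R} := Fps (conv *%R (fcoef p) (fcoef q)).
Definition fps1 : {fps R} := fpsC 1.

Let mulA : associative fps_mul.
Proof.
move=> p q r; apply/fpsP; apply: convA => [u x y|u|w x y|w|u v w].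
- exact: mulrDr.
- exact: mulr0.
- exact: mulrDl.
- exact: mul0r.
- exact: mulrA.
Qed.
Let mul1 : left_id fps1 fps_mul.
Proof.
move=> p; apply/fpsP => i /=; rewrite (@conv_deltal _ _ _ _ 1) ?mul1r //.
exact: mul0r.
Qed.
Let mulr1 : right_id fps1 fps_mul.
Proof.
move=> p; apply/fpsP => i /=; rewrite (@conv_deltar _ _ _ _ 1) ?mulr1 //.
exact: mulr0.
Qed.
Let mulDl : left_distributive fps_mul +%R.
Proof.
by move=> p q r; apply/fpsP => i; apply: convDl => v x y; apply: mulrDl.
Qed.
Let mulDr : right_distributive fps_mul +%R.
Proof.
by move=> p q r; apply/fpsP => i; apply: convDr => v x y; apply: mulrDr.
Qed.
Let one_neq0 : fps1 != 0.
Proof.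
apply/eqP => /(congr1 (fun p => fcoef p 0%N)) /= /eqP.
by apply/negP; apply: oner_neq0.
Qed.

HB.instance Definition _ := GRing.Zmodule_isNzRing.Build {fps R}
  mulA mul1 mulr1 mulDl mulDr one_neq0.

Lemma fcoefM p q i :
  fcoef (p * q) i = \sum_(j < i.+1) fcoef p j * fcoef q (i - j)%N.
Proof. by []. Qed.

Lemma fcoef1 i : fcoef (1 : {fps R}) i = if i == 0%N then 1 else 0.
Proof. by []. Qed.

Lemma fpsC_is_monoid_morphism : monoid_morphism (@fpsC R).
Proof.
split=> // a b; apply/fpsP => i.
rewrite /= (@conv_deltal _ _ _ _ a) //; last exact: mul0r.
by case: ifP; rewrite ?mulr0.
Qed.
HB.instance Definition _ :=
  GRing.isMonoidMorphism.Build R {fps R} (@fpsC R) fpsC_is_monoid_morphism.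

Definition fpsX : {fps R} := Fps (fun i => if i == 1%N then 1 else 0).

End FpsRing.

Notation "''t'" := (@fpsX _) : ring_scope.

Section FpsComRing.
Variable R : comNzRingType.
Lemma fps_mulC : @commutative {fps R} {fps R} *%R.
Proof.
move=> p q; apply/fpsP => i; rewrite fcoefM -[RHS]/(conv _ _ _ _) conv_rev.
by apply: eq_bigr => j _; apply: mulrC.
Qed.
HB.instance Definition _ :=
  GRing.PzRing_hasCommutativeMul.Build {fps R} fps_mulC.
End FpsComRing.

Section FpsIdomain.
Variable R : idomainType.
Implicit Types p q : {fps R}.

Definition fps_unit : pred {fps R} := fun p => `[< exists q, q * p = 1 >].
Definition fps_inv p : {fps R} :=
  if pselect (exists q, q * p = 1) is left h then projT1 (cid h) else p.

Let mulVr : {in fps_unit, left_inverse 1 fps_inv *%R}.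
Proof.
move=> p /asboolP up; rewrite /fps_inv; case: pselect => // h.
by case: (cid h).
Qed.
Let unitPl : forall p q, q * p = 1 -> fps_unit p.
Proof. by move=> p q e; apply/asboolP; exists q. Qed.
Let inv_out : {in [predC fps_unit], fps_inv =1 id}.
Proof. by move=> p /asboolP up; rewrite /fps_inv; case: pselect. Qed.

HB.instance Definition _ :=
  GRing.ComNzRing_hasMulInverse.Build {fps R} mulVr unitPl inv_out.

Lemma fps_neq0P p : p != 0 ->
  exists2 a, fcoef p a != 0 & forall i, (i < a)%N -> fcoef p i = 0.
Proof.
move=> p0; have /existsNP [a0 a0P] : ~ forall i, fcoef p i = 0.
  by move=> h; move/eqP: p0; apply; apply/fpsP.
have ex : exists a, fcoef p a != 0 by exists a0; apply/eqP.
exists (ex_minn ex); case: ex_minnP => // a pa amin i ia.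
by apply/eqP; apply: contraTT ia => /amin; rewrite -leqNgt.
Qed.

Let mul_eq0 : GRing.integral_domain_axiom {fps R}.
Proof.
move=> p q pq0; apply/norP => -[/fps_neq0P [a pa pa0] /fps_neq0P [b qb qb0]].
have := congr1 (fun r => fcoef r (a + b)%N) pq0; rewrite fcoefM.
have la : (a < (a + b).+1)%N by rewrite ltnS leq_addr.
rewrite (bigD1 (Ordinal la)) //= big1 ?addr0 ?addKn => [/eqP|i].
  by rewrite mulf_eq0 (negPf pa) (negPf qb).
rewrite -val_eqE neq_ltn /= => /orP [/pa0 ->|ai]; first by rewrite mul0r.
rewrite [X in _ * X]qb0 ?mulr0 // ltn_subLR ?ltn_add2r //.
exact: ltn_ord i.
Qed.

HB.instance Definition _ := GRing.ComUnitRing_isIntegral.Build {fps R} mul_eq0.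
End FpsIdomain.

Section FpsLmod.
Variables (R : comNzRingType) (V : lmodType R).
Implicit Types (a b : {fps R}) (v : {fps V}).

Definition fps_scale a v : {fps V} := Fps (conv *:%R (fcoef a) (fcoef v)).

Let scaleA a b v : fps_scale a (fps_scale b v) = fps_scale (a * b) v.
Proof.
apply/fpsP; apply: convA => [u x y|u|w x y|w|u w x].
- exact: scalerDr.
- exact: scaler0.
- exact: scalerDl.
- exact: scale0r.
- exact: scalerA.
Qed.
Let scale1 : left_id 1 fps_scale.
Proof.
move=> v; apply/fpsP => i /=; rewrite (@conv_deltal _ _ _ _ 1) ?scale1r //.
exact: scale0r.
Qed.
Let scaleDr : right_distributive fps_scale +%R.
Proof.
by move=> a v w; apply/fpsP => i; apply: convDr => u x y; apply: scalerDr.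
Qed.
Let scaleDl v : {morph fps_scale^~ v : a b / a + b}.
Proof.
by move=> a b; apply/fpsP => i; apply: convDl => u x y; apply: scalerDl.
Qed.

HB.instance Definition _ := GRing.Zmodule_isLmodule.Build {fps R} {fps V}
  scaleA scale1 scaleDr scaleDl.

Lemma fcoefZ a v i :
  fcoef (a *: v) i = \sum_(j < i.+1) fcoef a j *: fcoef v (i - j)%N.
Proof. by []. Qed.
End FpsLmod.

Record laurent (V : zmodType) := Laurent {
  lcoef : int -> V;
  laurent_bounded : exists m : nat, forall i : int, i < - m%:Z -> lcoef i = 0
}.
Notation "{ 'laurent' V }" := (laurent V)
  (at level 0, format "{ 'laurent'  V }").
Bind Scope ring_scope with laurent.

HB.instance Definition _ V := gen_eqMixin {laurent V}.
HB.instance Definition _ V := gen_choiceMixin {laurent V}.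

Lemma laurentP (V : zmodType) (x y : {laurent V}) :
  lcoef x =1 lcoef y <-> x = y.
Proof.
split=> [|-> //]; case: x y => x xb [y yb] /= /funext e; subst y.
by congr Laurent; apply: Prop_irrelevance.
Qed.

Section LaurentZmod.
Variable V : zmodType.
Implicit Types (x y z : {laurent V}) (p q : {fps V}).

(* x \in t ^ (- m) V{t} *)
Definition pole_le (m : nat) x := forall i : int, i < - m%:Z -> lcoef x i = 0.

(* x \in V[t, t^-1] *)
Definition is_laurent_poly x :=
  exists m : nat, forall i : int, m%:Z < i -> lcoef x i = 0.

(* t ^ (- m) * p, and conversely t ^ m * x truncated to its nonnegative part *)
Definition fps_div m p : int -> V :=
  fun i => if i + m%:Z is Posz k then fcoef p k else 0.

Lemma fps_div_bounded m p :
  exists n : nat, forall i : int, i < - n%:Z -> fps_div m p i = 0.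
Proof.
exists m => i im; rewrite /fps_div; case e: (i + m%:Z) => [k|k] //.
by move: im; rewrite -subr_lt0 opprK e.
Qed.

Definition laurent_of m p : {laurent V} := Laurent (fps_div_bounded m p).
Definition fps_of m x : {fps V} := Fps (fun k => lcoef x (k%:Z - m%:Z)).

Lemma pole_le_laurent_of m p : pole_le m (laurent_of m p).
Proof.
move=> i im; rewrite /= /fps_div; case e: (i + m%:Z) => [k|k] //.
by move: im; rewrite -subr_lt0 opprK e.
Qed.

Lemma laurent_ofK m p : fps_of m (laurent_of m p) = p.
Proof. by apply/fpsP => k /=; rewrite /fps_div subrK. Qed.

Lemma fps_ofK m x : pole_le m x -> laurent_of m (fps_of m x) = x.
Proof.
move=> xm; apply/laurentP => i /=; rewrite /fps_div.
case e: (i + m%:Z) => [k|k] /=; first by rewrite -e addrK.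
by rewrite xm // -subr_lt0 opprK e.
Qed.

Lemma pole_le_ex x : exists m, pole_le m x. Proof. by case: x. Qed.
Definition pole x : nat := projT1 (cid (pole_le_ex x)).
Lemma poleP x : pole_le (pole x) x. Proof. exact: (projT2 (cid (pole_le_ex x))). Qed.
Arguments poleP x _ _ : clear implicits.
Arguments pole_le_laurent_of m p _ _ : clear implicits.

Lemma pole_leW m n x : (m <= n)%N -> pole_le m x -> pole_le n x.
Proof.
move=> mn xm i il; apply: xm; apply: lt_le_trans il _.
by rewrite lerN2 lez_nat.
Qed.

Lemma laurent_of_inj m x y : pole_le m x -> pole_le m y ->
  fps_of m x = fps_of m y -> x = y.
Proof. by move=> /fps_ofK ex /fps_ofK ey e; rewrite -ex e ey. Qed.

Let bd0 : exists m : nat, forall i : int, i < - m%:Z -> (0 : V) = 0.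
Proof. by exists 0%N. Qed.
Definition laurent0 : {laurent V} := Laurent bd0.

Let bdN x : exists m : nat, forall i : int, i < - m%:Z -> - lcoef x i = 0.
Proof. by case: x => x [m h]; exists m => i /h /= ->; rewrite oppr0. Qed.
Definition laurent_opp x : {laurent V} := Laurent (bdN x).

Let bdD x y :
  exists m : nat, forall i : int, i < - m%:Z -> lcoef x i + lcoef y i = 0.
Proof.
exists (maxn (pole x) (pole y)) => i ilt.
rewrite (pole_leW _ (poleP x) ilt) ?leq_maxl //.
by rewrite (pole_leW _ (poleP y) ilt) ?leq_maxr // addr0.
Qed.
Definition laurent_add x y : {laurent V} := Laurent (bdD x y).

Let addA : associative laurent_add.
Proof. by move=> x y z; apply/laurentP => i /=; rewrite addrA. Qed.
Let addC : commutative laurent_add.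
Proof. by move=> x y; apply/laurentP => i /=; rewrite addrC. Qed.
Let add0 : left_id laurent0 laurent_add.
Proof. by move=> x; apply/laurentP => i /=; rewrite add0r. Qed.
Let addN : left_inverse laurent0 laurent_opp laurent_add.
Proof. by move=> x; apply/laurentP => i /=; rewrite addNr. Qed.

HB.instance Definition _ :=
  GRing.isZmodule.Build {laurent V} addA addC add0 addN.

Lemma lcoef0 i : lcoef (0 : {laurent V}) i = 0. Proof. by []. Qed.
Lemma lcoefN x i : lcoef (- x) i = - lcoef x i. Proof. by []. Qed.
Lemma lcoefD x y i : lcoef (x + y) i = lcoef x i + lcoef y i. Proof. by []. Qed.
Lemma lcoefB x y i : lcoef (x - y) i = lcoef x i - lcoef y i. Proof. by []. Qed.

Lemma fps_ofD m x y : fps_of m (x + y) = fps_of m x + fps_of m y.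
Proof. by []. Qed.

Lemma pole_leD m x y : pole_le m x -> pole_le m y -> pole_le m (x + y).
Proof. by move=> xm ym i im; rewrite lcoefD xm // ym // addr0. Qed.

End LaurentZmod.
Arguments poleP {V} x _ _.
Arguments pole_le_laurent_of {V} m p _ _.

Section LaurentRing.
Variable A : nzRingType.
Implicit Types (x y z : {laurent A}).

(* Since x = t ^ (- pole x) * fps_of (pole x) x, this is the Cauchy product.  *)
Definition laurent_mul x y : {laurent A} :=
  laurent_of (pole x + pole y) (fps_of (pole x) x * fps_of (pole y) y).

Lemma fps_of_shift m d x :
  fcoef (fps_of m x) =1 (fun i => fcoef (fps_of (m + d) x) (i + d)%N).
Proof. by move=> i; congr (lcoef x _); rewrite !PoszD opprD addrACA subrr addr0. Qed.

Lemma fps_of_vanish m d x : pole_le m x ->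
  forall i, (i < d)%N -> fcoef (fps_of (m + d) x) i = 0.
Proof.
move=> xm i id; apply: xm; rewrite /= PoszD opprD addrCA gtrDl subr_lt0.
by rewrite ltz_nat.
Qed.

Lemma fps_ofM_shiftl m n d x y : pole_le m x -> forall i,
  fcoef (fps_of m x * fps_of n y) i
    = fcoef (fps_of (m + d) x * fps_of n y) (i + d)%N.
Proof.
move=> xm i; rewrite -[LHS]/(conv _ _ _ _) -[RHS]/(conv _ _ _ _) conv_vanl.
- by apply: eq_conv => // j; apply: fps_of_shift.
- exact: mul0r.
- exact: mulr0.
- exact: fps_of_vanish.
Qed.

Lemma fps_ofM_shiftr m n d x y : pole_le n y -> forall i,
  fcoef (fps_of m x * fps_of n y) i
    = fcoef (fps_of m x * fps_of (n + d) y) (i + d)%N.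
Proof.
move=> yn i.
have flip (p q : {fps A}) k :
  fcoef (p * q) k = conv (fun a b => b * a) (fcoef q) (fcoef p) k.
  by rewrite conv_rev.
rewrite !flip conv_vanl.
- by apply: eq_conv => // j; apply: fps_of_shift.
- exact: mulr0.
- exact: mul0r.
- exact: fps_of_vanish.
Qed.

Lemma laurent_of_shift m d (p q : {fps A}) :
  (forall i, fcoef p i = fcoef q (i + d)%N) ->
  (forall i, (i < d)%N -> fcoef q i = 0) ->
  laurent_of m p = laurent_of (m + d) q.
Proof.
move=> e q0; apply/laurentP => i /=; rewrite /fps_div PoszD addrA.
case: (i + m%:Z) => k; first by rewrite -PoszD e.
case e': (Negz k + d%:Z) => [l|l] //; rewrite q0 //.
by rewrite -ltz_nat -e' gtrDr.
Qed.

Lemma fps_mul_vanishl d (p q : {fps A}) :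
  (forall i, (i < d)%N -> fcoef p i = 0) ->
  forall i, (i < d)%N -> fcoef (p * q) i = 0.
Proof.
move=> p0 i id; rewrite fcoefM big1 // => j _.
by rewrite p0 ?mul0r // (leq_ltn_trans _ id) // -ltnS ltn_ord.
Qed.

Lemma fps_mul_vanishr d (p q : {fps A}) :
  (forall i, (i < d)%N -> fcoef q i = 0) ->
  forall i, (i < d)%N -> fcoef (p * q) i = 0.
Proof.
move=> q0 i id; rewrite fcoefM big1 // => j _.
by rewrite q0 ?mulr0 // (leq_ltn_trans _ id) // leq_subr.
Qed.

Lemma laurent_mul_shift m n d e x y : pole_le m x -> pole_le n y ->
  laurent_of (m + n) (fps_of m x * fps_of n y)
  = laurent_of ((m + d) + (n + e)) (fps_of (m + d) x * fps_of (n + e) y).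
Proof.
move=> xm yn; transitivity
  (laurent_of (m + n + d) (fps_of (m + d) x * fps_of n y)).
  apply: laurent_of_shift; first exact: fps_ofM_shiftl.
  by apply: fps_mul_vanishl; apply: fps_of_vanish.
rewrite addnAC [in RHS]addnA; apply: laurent_of_shift.
  exact: fps_ofM_shiftr.
by apply: fps_mul_vanishr; apply: fps_of_vanish.
Qed.

Lemma laurent_mulE m n x y : pole_le m x -> pole_le n y ->
  laurent_mul x y = laurent_of (m + n) (fps_of m x * fps_of n y).
Proof.
move=> xm yn.
rewrite (laurent_mul_shift (pole x) (pole y) xm yn) /laurent_mul.
rewrite (laurent_mul_shift m n (poleP x) (poleP y)).
by rewrite [(m + _)%N]addnC [(n + _)%N]addnC.
Qed.

Lemma pole_leM m n x y : pole_le m x -> pole_le n y ->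
  pole_le (m + n) (laurent_mul x y).
Proof.
by move=> xm yn; rewrite (laurent_mulE xm yn); apply: pole_le_laurent_of.
Qed.

Lemma fps_ofM m n x y : pole_le m x -> pole_le n y ->
  fps_of (m + n) (laurent_mul x y) = fps_of m x * fps_of n y.
Proof. by move=> xm yn; rewrite (laurent_mulE xm yn) laurent_ofK. Qed.

Definition laurent1 : {laurent A} := laurent_of 0 1.

Let mulA : associative laurent_mul.
Proof.
move=> x y z; have [xp yp zp] := And3 (poleP x) (poleP y) (poleP z).
apply: (laurent_of_inj (m := (pole x + (pole y + pole z))%N)).
- by do 2!apply: pole_leM => //.
- by rewrite addnA; do 2!apply: pole_leM => //.
rewrite (fps_ofM xp (pole_leM yp zp)) (fps_ofM yp zp) mulrA -(fps_ofM xp yp).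
by rewrite -(fps_ofM (pole_leM xp yp) zp) addnA.
Qed.
Let mul1 : left_id laurent1 laurent_mul.
Proof.
move=> x; rewrite (laurent_mulE (pole_le_laurent_of 0 _) (poleP x)).
by rewrite add0n laurent_ofK mul1r fps_ofK //; apply: poleP.
Qed.
Let mulr1 : right_id laurent1 laurent_mul.
Proof.
move=> x; rewrite (laurent_mulE (poleP x) (pole_le_laurent_of 0 _)).
by rewrite addn0 laurent_ofK mulr1 fps_ofK //; apply: poleP.
Qed.
Let mulDl : left_distributive laurent_mul +%R.
Proof.
move=> x y z; set m := maxn (pole x) (pole y).
have xm : pole_le m x by apply: pole_leW _ (poleP x); apply: leq_maxl.
have ym : pole_le m y by apply: pole_leW _ (poleP y); apply: leq_maxr.
have zp := poleP z; apply: (laurent_of_inj (m := (m + pole z)%N)).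
- by apply/pole_leM/zp/pole_leD.
- by apply: pole_leD; apply: pole_leM.
by rewrite fps_ofD !fps_ofM ?fps_ofD ?mulrDl //; apply: pole_leD.
Qed.
Let mulDr : right_distributive laurent_mul +%R.
Proof.
move=> z x y; set m := maxn (pole x) (pole y).
have xm : pole_le m x by apply: pole_leW _ (poleP x); apply: leq_maxl.
have ym : pole_le m y by apply: pole_leW _ (poleP y); apply: leq_maxr.
have zp := poleP z; apply: (laurent_of_inj (m := (pole z + m)%N)).
- by apply/pole_leM/pole_leD.
- by apply: pole_leD; apply: pole_leM.
by rewrite fps_ofD !fps_ofM ?fps_ofD ?mulrDr //; apply: pole_leD.
Qed.
Let one_neq0 : laurent1 != 0.
Proof.
apply/eqP => /(congr1 (fun x => lcoef x 0)) /= /eqP.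
by apply/negP; apply: oner_neq0.
Qed.

HB.instance Definition _ := GRing.Zmodule_isNzRing.Build {laurent A}
  mulA mul1 mulr1 mulDl mulDr one_neq0.

Lemma laurentM m n x y : pole_le m x -> pole_le n y ->
  x * y = laurent_of (m + n) (fps_of m x * fps_of n y).
Proof. exact: laurent_mulE. Qed.

End LaurentRing.

Section LaurentAlg.
Variables (F : comNzRingType) (A : algType F).
Implicit Types (a b : {fps F}) (x y : {laurent A}).

(* {fps F} acts on {laurent A} through F -> A.                                *)
Definition laurent_inj a : {laurent A} :=
  laurent_of 0 (Fps (fun i => (fcoef a i)%:A)).

Lemma laurent_inj_zmod_morphism : zmod_morphism laurent_inj.
Proof.
move=> a b; apply/laurentP => i; rewrite lcoefB /= /fps_div.
by case: (i + 0) => k //=; rewrite ?subrr // scalerBl.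
Qed.
HB.instance Definition _ := GRing.isZmodMorphism.Build {fps F} {laurent A}
  laurent_inj laurent_inj_zmod_morphism.

Lemma laurent_inj_monoid_morphism : monoid_morphism laurent_inj.
Proof.
split=> [|a b].
  congr laurent_of; apply/fpsP => i /=.
  by case: ifP; rewrite ?scale1r ?scale0r.
rewrite (laurentM (pole_le_laurent_of 0 _) (pole_le_laurent_of 0 _)).
rewrite !laurent_ofK; congr laurent_of; apply/fpsP => i /=.
rewrite /conv scaler_suml; apply: eq_bigr => j _.
by rewrite -scalerAl mul1r scalerA.
Qed.
HB.instance Definition _ := GRing.isMonoidMorphism.Build {fps F} {laurent A}
  laurent_inj laurent_inj_monoid_morphism.

Lemma laurent_inj_comm a x : laurent_inj a * x = x * laurent_inj a.
Proof.
rewrite (laurentM (pole_le_laurent_of 0 _) (poleP x)).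
rewrite (laurentM (poleP x) (pole_le_laurent_of 0 _)) addnC.
congr laurent_of; apply/fpsP => i; rewrite !laurent_ofK.
rewrite -[LHS]/(conv _ _ _ _) conv_rev; apply: eq_bigr => j _ /=.
by rewrite -scalerAl mul1r -scalerAr mulr1.
Qed.

Definition laurent_scale a x := laurent_inj a * x.

Let scaleA a b x : laurent_scale a (laurent_scale b x) = laurent_scale (a * b) x.
Proof. by rewrite /laurent_scale mulrA -rmorphM. Qed.
Let scale1 : left_id 1 laurent_scale.
Proof. by move=> x; rewrite /laurent_scale rmorph1 mul1r. Qed.
Let scaleDr : right_distributive laurent_scale +%R.
Proof. by move=> a x y; apply: mulrDr. Qed.
Let scaleDl x : {morph laurent_scale^~ x : a b / a + b}.
Proof. by move=> a b; rewrite /laurent_scale rmorphD mulrDl. Qed.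

HB.instance Definition _ := GRing.Zmodule_isLmodule.Build {fps F} {laurent A}
  scaleA scale1 scaleDr scaleDl.

Let scaleAl a x y : a *: (x * y) = (a *: x) * y.
Proof. exact: mulrA. Qed.
HB.instance Definition _ :=
  GRing.Lmodule_isLalgebra.Build {fps F} {laurent A} scaleAl.

Let scaleAr a x y : a *: (x * y) = x * (a *: y).
Proof.
rewrite -[LHS]/(laurent_inj a * _) -[X in _ = _ * X]/(laurent_inj a * _).
by rewrite mulrA laurent_inj_comm -mulrA.
Qed.
HB.instance Definition _ :=
  GRing.Lalgebra_isAlgebra.Build {fps F} {laurent A} scaleAr.
End LaurentAlg.

(* {fmonom I} is the free monoid on I, so these are the linear combinations   *)
(* of words in rho letters.                                                   *)
Notation free_alg R rho := {malg R[{fmonom 'I_rho}]}.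

Section FreeAlg.
Variables (F : comNzRingType) (rho : nat).

Definition fvar (R : nzRingType) (i : 'I_rho) : free_alg R rho := << fmu i >>.

(* The inclusions of F<x> and of F<x>[t] into F<x>{t}.                        *)
Definition free_const (c : free_alg F rho) : free_alg {fps F} rho :=
  mmap (fun a => (fpsC a)%:MP) (fun w => << w >>) c.

Definition free_poly (q : {poly free_alg F rho}) : free_alg {fps F} rho :=
  \sum_(k < size q) 't ^+ k *: free_const q`_k.

End FreeAlg.
Arguments fvar {rho} R i.

Section Bases.
Variables (R : nzRingType) (V : lmodType R).

Definition lin_indep (I : eqType) (v : I -> V) :=
  forall (s : seq I) (a : I -> R), uniq s ->
    \sum_(i <- s) a i *: v i = 0 -> forall i, i \in s -> a i = 0.

Definition spanning (I : eqType) (v : I -> V) :=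
  forall x, exists (s : seq I) (a : I -> R), x = \sum_(i <- s) a i *: v i.

Definition is_basis (I : eqType) (v : I -> V) := lin_indep v /\ spanning v.

Definition free_module := exists (I : eqType) (v : I -> V), is_basis v.

End Bases.

(* A notation, because the quotients and tensor products below may be the     *)
(* zero ring and hence are not instances of algType.                          *)
Notation alg_isomorphic S A B :=
  (exists g : {rmorphism A -> B},
     bijective g /\ forall (c : S) x, g (c *: x) = c *: g x).

Section Image.
Variables (R : comNzRingType) (B : lalgType R) (D : algType R).
Variable f : {lrmorphism B -> D}.

Definition im_pred : pred D := fun y => `[< exists x, f x = y >].

Record im_alg := ImAlg { im_val : D; im_valP : im_pred im_val }.

HB.instance Definition _ := [isSub for im_val].
HB.instance Definition _ := [Choice of im_alg by <:].

Let im_closed : GRing.subalg_closed im_pred.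
Proof.
split; first by apply/asboolP; exists 1; rewrite rmorph1.
  move=> a _ _ /asboolP [x <-] /asboolP [y <-]; apply/asboolP.
  by exists (a *: x + y); rewrite linearP.
move=> _ _ /asboolP [x <-] /asboolP [y <-]; apply/asboolP.
by exists (x * y); rewrite rmorphM.
Qed.

HB.instance Definition _ := GRing.SubChoice_isSubAlgebra.Build R D im_pred im_alg
  (GRing.subalg_closed_semi im_closed).

End Image.

Section QuotientByT.
Variables (F : comNzRingType) (B : algType {fps F}).
Implicit Types x y : B.

(* The ideal tB, so that quot_t is B / tB, an algebra over F = {fps F} / t.   *)
Definition t_ideal : {pred B} := fun x => `[< exists y, x = 't *: y >].

Let t_ideal_zmod : zmod_closed t_ideal.
Proof.
split=> [|_ _ /asboolP [x ->] /asboolP [y ->]]; apply/asboolP.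
  by exists 0; rewrite scaler0.
by exists (x - y); rewrite scalerBr.
Qed.
HB.instance Definition _ := GRing.isZmodClosed.Build B t_ideal t_ideal_zmod.

Definition quot_t := {ideal_quot (t_ideal : zmodClosed B)}.
HB.instance Definition _ := GRing.Zmodule.on quot_t.
HB.instance Definition _ := Choice.on quot_t.

Definition pi_t (x : B) : quot_t := \pi_quot_t x.

Lemma pi_tP x y : pi_t x = pi_t y <-> exists z, x - y = 't *: z.
Proof.
rewrite /pi_t; split=> [e|h].
  by apply/asboolP; move/eqP: e; rewrite -Quotient.idealrBE.
by apply/eqP; rewrite -Quotient.idealrBE; apply/asboolP.
Qed.

Lemma pi_t_zmod_morphism : zmod_morphism pi_t.
Proof. by move=> x y; rewrite /pi_t !piE. Qed.
HB.instance Definition _ :=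
  GRing.isZmodMorphism.Build B quot_t pi_t pi_t_zmod_morphism.

Lemma pi_t_repr (u : quot_t) : pi_t (repr u) = u. Proof. exact: reprK. Qed.

Definition quot_t_mul (u v : quot_t) := pi_t (repr u * repr v).
Definition quot_t_scale (c : F) (u : quot_t) := pi_t (fpsC c *: repr u).

Lemma pi_tM x y : quot_t_mul (pi_t x) (pi_t y) = pi_t (x * y).
Proof.
have /pi_tP [z ez] := pi_t_repr (pi_t x).
have /pi_tP [w ew] := pi_t_repr (pi_t y).
apply/pi_tP; exists (z * repr (pi_t y) + x * w).
rewrite scalerDr scalerAl scalerAr -ez -ew mulrBl mulrBr.
by rewrite addrA subrK.
Qed.

Lemma pi_tZ c x : quot_t_scale c (pi_t x) = pi_t (fpsC c *: x).
Proof.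
have /pi_tP [z ez] := pi_t_repr (pi_t x).
by apply/pi_tP; exists (fpsC c *: z); rewrite -scalerBr ez !scalerA mulrC.
Qed.

Let mulA : associative quot_t_mul.
Proof.
move=> u v w; rewrite -[u]pi_t_repr -[v]pi_t_repr -[w]pi_t_repr.
by rewrite !pi_tM mulrA.
Qed.
Let mul1 : left_id (pi_t 1) quot_t_mul.
Proof. by move=> u; rewrite -[u]pi_t_repr pi_tM mul1r. Qed.
Let mulr1 : right_id (pi_t 1) quot_t_mul.
Proof. by move=> u; rewrite -[u]pi_t_repr pi_tM mulr1. Qed.
Let mulDl : left_distributive quot_t_mul +%R.
Proof.
move=> u v w; rewrite -[u]pi_t_repr -[v]pi_t_repr -[w]pi_t_repr.
by rewrite -raddfD !pi_tM mulrDl raddfD.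
Qed.
Let mulDr : right_distributive quot_t_mul +%R.
Proof.
move=> u v w; rewrite -[u]pi_t_repr -[v]pi_t_repr -[w]pi_t_repr.
by rewrite -raddfD !pi_tM mulrDr raddfD.
Qed.
HB.instance Definition _ := GRing.Zmodule_isPzRing.Build quot_t
  mulA mul1 mulr1 mulDl mulDr.

Let scaleA a b u : quot_t_scale a (quot_t_scale b u) = quot_t_scale (a * b) u.
Proof. by rewrite -[u]pi_t_repr !pi_tZ scalerA rmorphM. Qed.
Let scale1 : left_id 1 quot_t_scale.
Proof. by move=> u; rewrite -[u]pi_t_repr pi_tZ rmorph1 scale1r. Qed.
Let scaleDr : right_distributive quot_t_scale +%R.
Proof.
move=> a u v; rewrite -[u]pi_t_repr -[v]pi_t_repr.
by rewrite -raddfD !pi_tZ scalerDr raddfD.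
Qed.
Let scaleDl u : {morph quot_t_scale^~ u : a b / a + b}.
Proof.
by move=> a b; rewrite -[u]pi_t_repr !pi_tZ raddfD scalerDl raddfD.
Qed.
HB.instance Definition _ := GRing.Zmodule_isLmodule.Build F quot_t
  scaleA scale1 scaleDr scaleDl.

End QuotientByT.

Section Tensor.
Variables (R K : comNzRingType) (j : {rmorphism R -> K}) (B : algType R).
Implicit Types s r : seq (B * K).

(* tensor is B (x)_R K, where R acts on K through j, as a K-algebra.          *)
Definition balanced (V : zmodType) (phi : B -> K -> V) :=
  [/\ forall k, {morph phi^~ k : x y / x + y},
      forall x, {morph phi x : k l / k + l}
    & forall a x k, phi (a *: x) k = phi x (j a * k)].

Definition balanced_sum (V : zmodType) (phi : B -> K -> V) s : V :=
  \sum_(u <- s) phi u.1 u.2.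

(* A list of pairs stands for the sum of the corresponding pure tensors; two  *)
(* such sums agree when no balanced map distinguishes them.                   *)
Definition tensor_eq s r := `[< forall (V : zmodType) (phi : B -> K -> V),
  balanced phi -> balanced_sum phi s = balanced_sum phi r >].

Let tensor_eq_equiv : equiv_class_of tensor_eq.
Proof.
split=> [s|s r|r s u]; first by apply/asboolP.
  by apply/asboolP/asboolP => h V phi b; rewrite h.
by move=> /asboolP h /asboolP h'; apply/asboolP => V phi b; rewrite h ?h'.
Qed.
Canonical tensor_eq_equivRel := EquivRelPack tensor_eq_equiv.
Canonical tensor_eq_encModRel := defaultEncModRel tensor_eq.

Definition tensor := {eq_quot tensor_eq}.
HB.instance Definition _ : EqQuotient _ tensor_eq tensor := EqQuotient.on tensor.
HB.instance Definition _ := Choice.on tensor.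

Definition tsum s : tensor := \pi_tensor s.
Definition pure_tensor (x : B) (k : K) : tensor := tsum [:: (x, k)].

Lemma tsumP s r : tsum s = tsum r <-> forall (V : zmodType) (phi : B -> K -> V),
  balanced phi -> balanced_sum phi s = balanced_sum phi r.
Proof.
rewrite /tsum; split=> [e|h].
  by apply/asboolP; move/eqP: e; rewrite piE.
by apply/eqP; rewrite piE; apply/asboolP.
Qed.

Lemma tsum_repr (u : tensor) : tsum (repr u) = u. Proof. exact: reprK. Qed.

Definition tensor_opp_seq s := [seq (- u.1, u.2) | u <- s].
Definition tensor_scale_seq (k : K) s := [seq (u.1, k * u.2) | u <- s].
Definition tensor_mul_seq s r :=
  [seq (u.1 * v.1, u.2 * v.2) | u <- s, v <- r].

Definition tensor_add (u v : tensor) := tsum (repr u ++ repr v).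
Definition tensor_opp (u : tensor) := tsum (tensor_opp_seq (repr u)).
Definition tensor_mul (u v : tensor) := tsum (tensor_mul_seq (repr u) (repr v)).
Definition tensor_scale (k : K) (u : tensor) :=
  tsum (tensor_scale_seq k (repr u)).

Section Balanced.
Variables (V : zmodType) (phi : B -> K -> V).
Hypothesis phiB : balanced phi.

Lemma balanced0l k : phi 0 k = 0.
Proof.
by have [D _ _] := phiB; apply: (addrI (phi 0 k)); rewrite -D !addr0.
Qed.

Lemma balancedNl x k : phi (- x) k = - phi x k.
Proof.
have [D _ _] := phiB; apply: (addrI (phi x k)).
by rewrite -D !subrr balanced0l.
Qed.

Lemma balanced_sum_cat s r :
  balanced_sum phi (s ++ r) = balanced_sum phi s + balanced_sum phi r.
Proof. exact: big_cat. Qed.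

Lemma balanced_sum_opp s :
  balanced_sum phi (tensor_opp_seq s) = - balanced_sum phi s.
Proof.
rewrite /balanced_sum big_map -sumrN; apply: eq_bigr => u _.
exact: balancedNl.
Qed.

Lemma balanced_sum_scale k s : balanced_sum phi (tensor_scale_seq k s)
  = balanced_sum (fun x l => phi x (k * l)) s.
Proof. exact: big_map. Qed.

Lemma balanced_scale k : balanced (fun x l => phi x (k * l)).
Proof.
have [Dl Dr S] := phiB; split=> [l|x l l'|a x l]; first exact: Dl.
  by rewrite mulrDr Dr.
by rewrite S mulrCA.
Qed.

Lemma balanced_sum_mul s r : balanced_sum phi (tensor_mul_seq s r)
  = balanced_sum (fun x k =>
      balanced_sum (fun y l => phi (x * y) (k * l)) r) s.
Proof. exact: big_allpairs_dep. Qed.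

Lemma balanced_mull x k : balanced (fun y l => phi (x * y) (k * l)).
Proof.
have [Dl Dr S] := phiB; split=> [l y y'|y l l'|a y l].
- by rewrite mulrDr Dl.
- by rewrite mulrDr Dr.
- by rewrite -scalerAr S mulrCA.
Qed.

Lemma balanced_mulr r :
  balanced (fun x k => balanced_sum (fun y l => phi (x * y) (k * l)) r).
Proof.
have [Dl Dr S] := phiB; split=> [k x x'|x k k'|a x k].
- by rewrite -big_split; apply: eq_bigr => u _ /=; rewrite mulrDl Dl.
- by rewrite -big_split; apply: eq_bigr => u _ /=; rewrite mulrDl Dr.
- by apply: eq_bigr => u _; rewrite -scalerAl S mulrA.
Qed.

End Balanced.

Lemma tsumD s r : tensor_add (tsum s) (tsum r) = tsum (s ++ r).
Proof.
have /tsumP es := tsum_repr (tsum s); have /tsumP er := tsum_repr (tsum r).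
by apply/tsumP => V phi b; rewrite !balanced_sum_cat es ?er.
Qed.

Lemma tsumN s : tensor_opp (tsum s) = tsum (tensor_opp_seq s).
Proof.
have /tsumP es := tsum_repr (tsum s).
by apply/tsumP => V phi b; rewrite !balanced_sum_opp ?es.
Qed.

Lemma tsumZ k s : tensor_scale k (tsum s) = tsum (tensor_scale_seq k s).
Proof.
have /tsumP es := tsum_repr (tsum s); apply/tsumP => V phi b.
by rewrite !balanced_sum_scale es //; apply: balanced_scale.
Qed.

Lemma tsumM s r : tensor_mul (tsum s) (tsum r) = tsum (tensor_mul_seq s r).
Proof.
have /tsumP es := tsum_repr (tsum s); have /tsumP er := tsum_repr (tsum r).
apply/tsumP => V phi b; rewrite !balanced_sum_mul es; last exact: balanced_mulr.
by apply: eq_bigr => u _; apply: er; apply: balanced_mull.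
Qed.

Let addA : associative tensor_add.
Proof.
move=> u v w; rewrite -[u]tsum_repr -[v]tsum_repr -[w]tsum_repr.
by rewrite !tsumD catA.
Qed.
Let addC : commutative tensor_add.
Proof.
move=> u v; rewrite -[u]tsum_repr -[v]tsum_repr !tsumD.
by apply/tsumP => V phi b; rewrite !balanced_sum_cat addrC.
Qed.
Let add0 : left_id (tsum [::]) tensor_add.
Proof. by move=> u; rewrite -[u]tsum_repr tsumD. Qed.
Let addN : left_inverse (tsum [::]) tensor_opp tensor_add.
Proof.
move=> u; rewrite -[u]tsum_repr tsumN tsumD; apply/tsumP => V phi b.
by rewrite balanced_sum_cat balanced_sum_opp // addNr /balanced_sum big_nil.
Qed.
HB.instance Definition _ := GRing.isZmodule.Build tensor addA addC add0 addN.

Lemma tsum_cat s r : tsum s + tsum r = tsum (s ++ r). Proof. exact: tsumD. Qed.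

Let mulA : associative tensor_mul.
Proof.
move=> u v w; rewrite -[u]tsum_repr -[v]tsum_repr -[w]tsum_repr !tsumM.
apply/tsumP => V phi b; rewrite !balanced_sum_mul; apply: eq_bigr => x _.
rewrite !balanced_sum_mul; apply: eq_bigr => y _.
by apply: eq_bigr => z _; rewrite !mulrA.
Qed.
Let mul1 : left_id (pure_tensor 1 1) tensor_mul.
Proof.
move=> u; rewrite -[u]tsum_repr tsumM; apply/tsumP => V phi b.
rewrite balanced_sum_mul /balanced_sum big_seq1 /=.
by apply: eq_bigr => x _; rewrite !mul1r.
Qed.
Let mulr1 : right_id (pure_tensor 1 1) tensor_mul.
Proof.
move=> u; rewrite -[u]tsum_repr tsumM; apply/tsumP => V phi b.
rewrite balanced_sum_mul; apply: eq_bigr => x _.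
by rewrite /balanced_sum big_seq1 !mulr1.
Qed.
Let mulDl : left_distributive tensor_mul +%R.
Proof.
move=> u v w; rewrite -[u]tsum_repr -[v]tsum_repr -[w]tsum_repr.
rewrite tsum_cat !tsumM tsum_cat.
apply/tsumP => V phi b.
by rewrite balanced_sum_mul !balanced_sum_cat !balanced_sum_mul.
Qed.
Let mulDr : right_distributive tensor_mul +%R.
Proof.
move=> u v w; rewrite -[u]tsum_repr -[v]tsum_repr -[w]tsum_repr.
rewrite tsum_cat !tsumM tsum_cat.
apply/tsumP => V phi b.
rewrite balanced_sum_cat !balanced_sum_mul -big_split.
by apply: eq_bigr => x _; rewrite balanced_sum_cat.
Qed.
HB.instance Definition _ := GRing.Zmodule_isPzRing.Build tensor
  mulA mul1 mulr1 mulDl mulDr.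

Let scaleA k l u : tensor_scale k (tensor_scale l u) = tensor_scale (k * l) u.
Proof.
rewrite -[u]tsum_repr !tsumZ; apply/tsumP => V phi b.
by rewrite !balanced_sum_scale; apply: eq_bigr => x _; rewrite mulrA.
Qed.
Let scale1 : left_id 1 tensor_scale.
Proof.
move=> u; rewrite -[u]tsum_repr tsumZ; apply/tsumP => V phi b.
by rewrite balanced_sum_scale; apply: eq_bigr => x _; rewrite mul1r.
Qed.
Let scaleDr : right_distributive tensor_scale +%R.
Proof.
move=> k u v; rewrite -[u]tsum_repr -[v]tsum_repr.
rewrite tsum_cat !tsumZ tsum_cat.
by congr tsum; apply: map_cat.
Qed.
Let scaleDl u : {morph tensor_scale^~ u : k l / k + l}.
Proof.
move=> k l; rewrite -[u]tsum_repr !tsumZ.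
rewrite !tsum_cat.
apply/tsumP => V phi b; have [_ D _] := b.
rewrite balanced_sum_cat !balanced_sum_scale -big_split.
by apply: eq_bigr => x _; rewrite mulrDl D.
Qed.
HB.instance Definition _ := GRing.Zmodule_isLmodule.Build K tensor
  scaleA scale1 scaleDr scaleDl.

End Tensor.

Section AlgLaw.
Variables (R : comNzRingType) (M : lmodType R).

(* The unital associative R-algebra structures on the module M; law_alg star  *)
(* is M equipped with star.                                                   *)
Record alg_law := AlgLaw {
  law_mul :> M -> M -> M;
  law_one : M;
  law_mulA : associative law_mul;
  law_mul1 : left_id law_one law_mul;
  law_mulr1 : right_id law_one law_mul;
  law_mulDl : left_distributive law_mul +%R;
  law_mulDr : right_distributive law_mul +%R;
  law_scaleAl : forall (a : R) x y, a *: law_mul x y = law_mul (a *: x) y;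
  law_scaleAr : forall (a : R) x y, a *: law_mul x y = law_mul x (a *: y);
  law_one_neq0 : law_one != 0
}.

Definition law_alg (star : alg_law) : Type := M.

Variable star : alg_law.
HB.instance Definition _ := GRing.Lmodule.on (law_alg star).
HB.instance Definition _ := GRing.Zmodule_isNzRing.Build (law_alg star)
  (law_mulA star) (law_mul1 star) (law_mulr1 star) (law_mulDl star)
  (law_mulDr star) (law_one_neq0 star).
HB.instance Definition _ := GRing.Lmodule_isLalgebra.Build R (law_alg star)
  (law_scaleAl star).
HB.instance Definition _ := GRing.Lalgebra_isAlgebra.Build R (law_alg star)
  (law_scaleAr star).

End AlgLaw.

Section Deformations.
Variable F : fieldType.

Definition formal_deformation (N : algType F) (star : alg_law {fps N}) :=
  alg_isomorphic F N (quot_t (law_alg star)).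

(* The map s lifts the isomorphism g along B -> B / tB; it sends the identity *)
(* of N to the identity of B.                                                 *)
Definition deformation (N : algType F) (B : algType {fps F}) :=
  free_module B /\
  exists (g : {rmorphism N -> quot_t B}) (s : {additive N -> B}),
    [/\ bijective g, forall (c : F) x, g (c *: x) = c *: g x,
        forall (c : F) x, s (c *: x) = fpsC c *: s x,
        forall x, pi_t (s x) = g x & s 1 = 1].

Definition fraction_closure (K : fieldType)
    (j : {rmorphism {fraction {fps F}} -> K}) :=
  GRing.closed_field_axiom K /\ forall x : K, algebraicOver j x.

(* The algebraic closure of the fraction field is determined up to            *)
(* isomorphism only, hence the quantification over K.                         *)
Definition flat_deformation (N A : algType F) (B : algType {fps F}) :=
  deformation N B /\
  forall (K : fieldType) (j : {rmorphism {fraction {fps F}} -> K}),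
    fraction_closure j ->
    alg_isomorphic K (tensor (j \o @tofrac _) B)
      (tensor (j \o @tofrac _ \o @fpsC F) A).

End Deformations.

(* Main.v *)
From HB Require Import structures.
Require Import Defs.
From mathcomp Require Import all_boot all_order all_algebra all_field.
From mathcomp Require Import boolp reals complex.
From mathcomp Require Import monalg.

Set Implicit Arguments.
Unset Strict Implicit.
Unset Printing Implicit Defensive.

Import GRing.Theory.
Local Open Scope ring_scope.

(** Write [O] for the power series over the ground field [F] and [M] for the
image of [f].  Since all poles in [M] have order at most [gamma], [M] is an
[O]-submodule of [t^(-gamma) A{t}], a free [O]-module of rank [n]; and [M]
contains [n] independent elements.

Basis of [M].  As [O] is a discrete valuation ring, a basis of [M] can be
chosen among the elements [f c] with [c] a constant noncommutative polynomial:
take [c_1, ..., c_n] for which the determinant of the coordinates of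
[f c_1, ..., f c_n] is nonzero of the least possible order in [t].  Every other
[f c] is a combination of these with coefficients given by Cramer's rule, that
is, quotients of two such determinants, and they lie in [O] by minimality
([min_order_basis]).  The elements [f c] span [M] over [O], so the constant
polynomials [q_i = c_i] do the job ([im_const_basis]).

The algebra [N].  The structure constants of [M] in the basis are in [O]; their
constant terms are those of an associative unital product on [F^n], because
reducing coordinates modulo [t] is a surjection [M -> F^n] whose kernel is the
ideal [t M] ([reduction_mod_t]).  The product of [M] itself is carried to [N{t}]
along the [O]-linear bijection that matches the two bases; this is the
deformation.  Lifting a basis of [N] gives the required linear section of
[M -> N], corrected along a functional which is nonzero on the identity so as
to send 1 to 1 ([unital_linear_section]).

Comparison with [A].  Over a field [K] containing the fractions of [O], [M] and
[A] become isomorphic.  The determinant [delta] above satisfies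
[delta A <= M], again by Cramer's rule ([multiple_in_image]), so
[a (x) k |-> delta a (x) k / delta] is an algebra morphism from [A (x)_F K] to
[M (x)_O K].  It is bijective as it sends a basis to elements with an invertible
coordinate matrix ([tensor_iso_of_multiple]). *)

(** * Finite bases and coordinates *)

Section FiniteBases.
Variables (R : comNzRingType) (V : lmodType R) (n : nat).
Implicit Types (v : 'I_n -> V) (x : V).

(** The coefficients off a given duplicate-free list can be taken to be 0, so for
a family indexed by ['I_n] it suffices to test the full sum. *)
Lemma lin_indep_ordP v : lin_indep v <->
  forall r : 'rV[R]_n, \sum_i r 0 i *: v i = 0 -> r = 0.
Proof.
split=> [vI r r0|vI s a us sa0 i si].
  apply/rowP => i; rewrite mxE.
  by apply: (vI (index_enum 'I_n) (r 0)) (mem_index_enum i) => //;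
    apply: index_enum_uniq.
have := vI (\row_k (if k \in s then a k else 0)).
rewrite (eq_bigr (fun k => if k \in s then a k *: v k else 0)); last first.
  by move=> k _; rewrite mxE; case: ifP; rewrite ?scale0r.
rewrite -big_mkcond -big_uniq //= => /(_ sa0) /rowP /(_ i).
by rewrite !mxE si.
Qed.

Lemma delta_comb v i : \sum_k (delta_mx 0 i : 'rV[R]_n) 0 k *: v k = v i.
Proof.
rewrite (bigD1 i) //= big1 => [|k ki]; first by rewrite !mxE !eqxx scale1r addr0.
by rewrite !mxE (negPf ki) andbF scale0r.
Qed.

(** Coordinates are collected in a row vector, so that changes of basis become
matrix products and independence a statement on determinants. *)
Lemma basis_coord v : is_basis v -> exists kappa : {linear V -> 'rV[R]_n},
  (forall r : 'rV[R]_n, kappa (\sum_i r 0 i *: v i) = r)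
  /\ forall x, x = \sum_i kappa x 0 i *: v i.
Proof.
move=> [/lin_indep_ordP vI vS].
have /choice [k kE] x : exists r : 'rV[R]_n, x = \sum_i r 0 i *: v i.
  have [s [a ->]] := vS x.
  exists (\sum_(i <- s) a i *: delta_mx 0 i).
  transitivity (\sum_(i <- s) \sum_k (a i *: delta_mx 0 i : 'rV_n) 0 k *: v k).
    apply: eq_bigr => i _; rewrite -[v i]delta_comb scaler_sumr.
    by apply: eq_bigr => k _; rewrite [in RHS]mxE scalerA.
  rewrite exchange_big; apply: eq_bigr => k _.
  by rewrite summxE scaler_suml.
have kU x (r : 'rV[R]_n) : x = \sum_i r 0 i *: v i -> k x = r.
  move=> e; apply/eqP; rewrite -subr_eq0; apply/eqP/vI.
  under eq_bigr do rewrite !mxE scalerBl.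
  by rewrite sumrB -kE -e subrr.
have kL : linear k.
  move=> a x y; apply: kU; rewrite {1}[x]kE {1}[y]kE scaler_sumr -big_split.
  by apply: eq_bigr => i _; rewrite !mxE scalerDl scalerA.
pose kM := GRing.isLinear.Build R V 'rV[R]_n *:%R k kL.
pose kappa : {linear V -> 'rV[R]_n} := HB.pack k kM.
by exists kappa; split=> [r|x] /=; [apply: kU | apply: kE].
Qed.

Lemma is_basis_ord v :
  (forall r : 'rV[R]_n, \sum_i r 0 i *: v i = 0 -> r = 0) ->
  (forall x, exists r : 'rV[R]_n, x = \sum_i r 0 i *: v i) -> is_basis v.
Proof.
move=> vI vS; split; first exact/lin_indep_ordP.
by move=> x; have [r ->] := vS x; exists (index_enum 'I_n), (r 0).
Qed.

End FiniteBases.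

Lemma lin_indep_linear (R : comNzRingType) (V W : lmodType R) (h : {linear V -> W})
    n (v : 'I_n -> V) :
  injective h -> lin_indep (h \o v) <-> lin_indep v.
Proof.
move=> hI; rewrite !lin_indep_ordP.
have E (r : 'rV[R]_n) : h (\sum_i r 0 i *: v i) = \sum_i r 0 i *: (h \o v) i.
  by rewrite linear_sum; apply: eq_bigr => i _; rewrite linearZ.
split=> vI r; first by move=> r0; apply: vI; rewrite -E r0 linear0.
by rewrite -E -(linear0 h) => /hI; apply: vI.
Qed.

(** The identity of an [algType] is nonzero, so it is not the empty sum. *)
Lemma basis_size_gt0 (R : comNzRingType) (B : algType R) n (b : 'I_n -> B) :
  is_basis b -> (0 < n)%N.
Proof.
case: n b => // b /basis_coord [kappa [_ bE]].
by have /eqP := bE 1; rewrite big_ord0 oner_eq0.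
Qed.

Lemma vbasis_is_basis (F : fieldType) (A : falgType F) :
  is_basis (fun i : 'I_(\dim {:A}) => (vbasis {:A})`_i).
Proof.
have /freeP e_free := basis_free (vbasisP {:A}).
apply: is_basis_ord => [r r0|x].
  by apply/rowP => i; rewrite mxE; apply: e_free r0 i.
exists (\row_i coord (vbasis {:A}) i x); rewrite {1}(coord_vbasis (memvf x)).
by apply: eq_bigr => i _; rewrite mxE.
Qed.

Lemma rmorphism_inverse (A B : pzRingType) (g : {rmorphism A -> B}) :
  bijective g -> exists h : {rmorphism B -> A}, cancel g h /\ cancel h g.
Proof.
move=> [h gK hK].
have hB : zmod_morphism h by move=> x y; apply: (can_inj gK); rewrite rmorphB !hK.
have hM : monoid_morphism h.
  split=> [|x y]; apply: (can_inj gK); first by rewrite hK rmorph1.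
  by rewrite rmorphM !hK.
pose hBm := GRing.isZmodMorphism.Build B A h hB.
pose hMm := GRing.isMonoidMorphism.Build B A h hM.
by exists (HB.pack_for {rmorphism B -> A} h hBm hMm).
Qed.

(** * Divisibility of power series *)

Section PowerSeries.
Variable F : fieldType.
Implicit Types p q : {fps F}.

Lemma fcoef_tM p i : fcoef ('t * p) i.+1 = fcoef p i.
Proof.
rewrite fcoefM big_ord_recl big_ord_recl big1 => [|k _] /=.
  by rewrite mul0r mul1r add0r addr0 subSS subn0.
by rewrite mul0r.
Qed.

Lemma fcoef_tM0 p : fcoef ('t * p) 0 = 0.
Proof. by rewrite fcoefM big_ord_recl big_ord0 mul0r addr0. Qed.

Lemma fps_split p : p = fpsC (fcoef p 0) + 't * Fps (fun i => fcoef p i.+1).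
Proof.
by apply/fpsP => -[|i]; rewrite fcoefD ?fcoef_tM0 ?fcoef_tM /= ?addr0 ?add0r.
Qed.

Lemma fcoef_tXM k p i : fcoef ('t ^+ k * p) (i + k) = fcoef p i.
Proof.
by elim: k => [|k IHk]; rewrite ?expr0 ?mul1r ?addn0 // exprS -mulrA addnS fcoef_tM.
Qed.

Lemma fcoef_tXM_lt k p i : (i < k)%N -> fcoef ('t ^+ k * p) i = 0.
Proof.
elim: k i => // k IHk [|i] ik; rewrite exprS -mulrA ?fcoef_tM0 //.
by rewrite fcoef_tM IHk.
Qed.

Lemma fps_tX_split k p : (forall i, (i < k)%N -> fcoef p i = 0) ->
  p = 't ^+ k * Fps (fun i => fcoef p (i + k)).
Proof.
move=> p0; apply/fpsP => i; have [ik|ki] := ltnP i k.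
  by rewrite p0 ?fcoef_tXM_lt.
by rewrite -(subnK ki) fcoef_tXM.
Qed.

(** After division by its constant term the series is [1 - t x], whose inverse is the
geometric series.  The coefficient of index [i] of that series is read off its
partial sum of length [i.+1], as the powers beyond vanish there. *)
Lemma fps_inv_ex p : fcoef p 0 != 0 -> exists q, q * p = 1.
Proof.
move=> p0; set c := fcoef p 0 in p0.
have [x ex] : exists x, p = fpsC c * (1 - 't * x).
  exists (- (fpsC c^-1 * Fps (fun i => fcoef p i.+1))).
  rewrite mulrN opprK mulrDr mulr1 {1}[p]fps_split; congr (_ + _).
  by rewrite mulrCA [fpsC c * _]mulrA -rmorphM divff // rmorph1 mul1r.
pose S m := \sum_(k < m) ('t * x) ^+ k.
pose q := Fps (fun i => fcoef (S i.+1) i).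
have Sstab i d : fcoef (S (i.+1 + d)%N) i = fcoef (S i.+1) i.
  elim: d => [|d IHd]; first by rewrite addn0.
  by rewrite addnS [S _.+1]big_ord_recr fcoefD IHd exprMn fcoef_tXM_lt ?addr0 ?leq_addr.
have qx : q * (1 - 't * x) = 1.
  apply/fpsP => i; transitivity (fcoef (S i.+1 * (1 - 't * x)) i).
    rewrite !fcoefM; apply: eq_bigr => j _; congr (_ * _) => /=.
    by have := Sstab j (i - j)%N; rewrite addSn subnKC ?leq_ord // => ->.
  have -> : S i.+1 * (1 - 't * x) = 1 - ('t * x) ^+ i.+1.
    by rewrite mulrC -[RHS]opprB subrX1 -[RHS]mulNr opprB.
  by rewrite fcoefB exprMn fcoef_tXM_lt // subr0.
have cV : fpsC c^-1 * fpsC c = 1 by rewrite -rmorphM mulVf // rmorph1.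
by exists (fpsC c^-1 * q); rewrite ex mulrACA cV qx mulr1.
Qed.

(** A relation rather than a function of [p], as the zero series has no order. *)
Definition has_order p k := fcoef p k != 0 /\ forall i, (i < k)%N -> fcoef p i = 0.

Lemma has_order_dvd p q k l :
  has_order p k -> has_order q l -> (k <= l)%N -> exists r, q = r * p.
Proof.
move=> [pk p0] [_ q0] kl.
rewrite (fps_tX_split p0) (fps_tX_split q0).
set p' := Fps (fun i => fcoef p (i + k)); set q' := Fps (fun i => fcoef q (i + l)).
have p'0 : fcoef p' 0 != 0 by [].
have [p'V p'VK] := fps_inv_ex p'0.
exists ('t ^+ (l - k) * q' * p'V).
by rewrite mulrACA p'VK mulr1 mulrAC -exprD subnK.
Qed.

End PowerSeries.

(** * Bases over power series by least determinant *)

(** Cramer's rule: expanding the right-hand side along row [k] only involves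
cofactors of [P]. *)
Lemma mul_row_adjE (R : comNzRingType) n (P : 'M[R]_n) (r : 'rV[R]_n) k :
  (r *m \adj P) 0 k
  = \det (\matrix_i (if i == k then r else row i P)).
Proof.
set P' := \matrix_i _; rewrite (expand_det_row P' k) mxE.
apply: eq_bigr => j _; rewrite !mxE eqxx; congr (_ * (_ * \det _)).
by apply/matrixP => a b; rewrite !mxE eq_sym (negPf (neq_lift _ _)) mxE.
Qed.

Section LatticeBasis.
Variables (F : fieldType) (V : lmodType {fps F}) (n : nat).
Variables (kappa : {linear V -> 'rV[{fps F}]_n}) (I : Type) (g : I -> V).
Hypothesis kappa_inj : injective kappa.

Let P (c : 'I_n -> I) : 'M[{fps F}]_n := \matrix_i kappa (g (c i)).

Lemma kappa_comb c (r : 'rV[{fps F}]_n) :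
  kappa (\sum_i r 0 i *: g (c i)) = r *m P c.
Proof.
rewrite mulmx_sum_row linear_sum; apply: eq_bigr => i _.
by rewrite linearZ /= rowK.
Qed.

Lemma lin_indep_det c : lin_indep (g \o c) <-> \det (P c) != 0.
Proof.
rewrite lin_indep_ordP; split=> [cI|d0 r r0].
  apply/negP => /det0P [r r0 rP]; case/negP: r0; apply/eqP/cI.
  by apply: kappa_inj; rewrite kappa_comb rP linear0.
apply/eqP; apply: contraNT d0 => r0'; apply/det0P; exists r => //.
by rewrite -kappa_comb r0 linear0.
Qed.

(** A choice of [c] whose determinant has least order works: by Cramer's rule
the coefficients of [g i] are quotients of determinants, where the numerator is
the determinant of another choice, with one [c l] replaced by [i].  If nonzero, it
has at least the order of the denominator, which therefore divides it. *)
Lemma min_order_basis :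
  (forall x, exists s : seq ({fps F} * I), x = \sum_(p <- s) p.1 *: g p.2) ->
  (exists c : 'I_n -> I, lin_indep (g \o c)) ->
  exists c : 'I_n -> I, is_basis (g \o c).
Proof.
move=> gS [c0 /lin_indep_det d0].
pose attained k := `[< exists c, has_order (\det (P c)) k >].
have ex : exists k, attained k.
  by have [k dk dk0] := fps_neq0P d0; exists k; apply/asboolP; exists c0.
case: (ex_minnP ex) => k /asboolP [c ck] kmin.
have dc0 : \det (P c) != 0.
  by apply: contraTneq ck.1 => ->; rewrite fcoef0 eqxx.
have gE i : exists r : 'rV[{fps F}]_n, g i = \sum_k r 0 k *: g (c k).
  have /choice [r rE] l : exists r, (kappa (g i) *m \adj (P c)) 0 l = r * \det (P c).
    rewrite mul_row_adjE.
    pose c' j := if j == l then i else c j.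
    set Q := \matrix_j _; have -> : Q = P c'.
      by apply/row_matrixP => j; rewrite !rowK /c'; case: eqP.
    have [->|/fps_neq0P [m dm dm0]] := eqVneq (\det (P c')) 0.
      by exists 0; rewrite mul0r.
    have om : has_order (\det (P c')) m by [].
    by apply: (has_order_dvd ck om); apply: kmin; apply/asboolP; exists c'.
  exists (\row_l r l); apply: kappa_inj; rewrite (kappa_comb c).
  apply/rowP => l; apply: (mulfI dc0).
  have /rowP /(_ l) : kappa (g i) *m (\adj (P c) *m P c) =
      \det (P c) *: ((\row_l r l) *m P c).
    rewrite mulmxA scalemxAl; congr (_ *m _); apply/rowP => l'.
    by rewrite rE !mxE mulrC.
  by rewrite mul_adj_mx mul_mx_scalar !mxE.
exists c; apply: is_basis_ord; first exact/lin_indep_ordP/lin_indep_det.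
move=> x; have [s ->] := gS x; have /choice [r rE] := gE.
exists (\sum_(p <- s) p.1 *: r p.2).
rewrite (eq_bigr (fun p => \sum_k (p.1 * r p.2 0 k) *: g (c k))) => [|p _]; last first.
  by rewrite {1}rE scaler_sumr; apply: eq_bigr => k' _; rewrite scalerA.
rewrite exchange_big; apply: eq_bigr => k' _.
by rewrite summxE scaler_suml; apply: eq_bigr => i _; rewrite mxE.
Qed.

End LatticeBasis.

(** * Reduction modulo t *)

Section LawAlongSurjection.
Variables (R R' : comNzRingType) (B : algType R') (V : lmodType R).
Variables (iota : R -> R') (rho : {additive B -> V}) (sigma : V -> B).
Hypotheses (rhoK : cancel sigma rho)
  (rhoZ : forall c x, rho (iota c *: x) = c *: rho x)
  (rhoM : forall x y, rho (x * y) = rho (sigma (rho x) * sigma (rho y)))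
  (V_neq0 : exists v : V, v != 0).

(** The product of [B] descends along a surjection [rho] if [rho (x * y)] depends
only on [rho x] and [rho y]; [rhoM] says this with the section [sigma].  It is
used both for reduction modulo [t], with [iota] the inclusion of constants, and
for carrying a product along a bijection, with [iota] the identity. *)
Lemma law_along_surjection : exists (law : alg_law V)
  (rho' : {rmorphism B -> law_alg law}), rho' =1 rho.
Proof.
pose mul u v := rho (sigma u * sigma v).
have mulE x y : mul (rho x) (rho y) = rho (x * y) by rewrite rhoM.
have rhoP u : exists x, u = rho x by exists (sigma u); rewrite rhoK.
have mulA : associative mul.
  move=> u v w; have [[x ->] [y ->] [z ->]] := And3 (rhoP u) (rhoP v) (rhoP w).
  by rewrite !mulE mulrA.
have mul1 : left_id (rho 1) mul.
  by move=> u; have [x ->] := rhoP u; rewrite mulE mul1r.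
have mulr1 : right_id (rho 1) mul.
  by move=> u; have [x ->] := rhoP u; rewrite mulE mulr1.
have mulDl : left_distributive mul +%R.
  move=> u v w; have [[x ->] [y ->] [z ->]] := And3 (rhoP u) (rhoP v) (rhoP w).
  by rewrite -raddfD !mulE mulrDl raddfD.
have mulDr : right_distributive mul +%R.
  move=> u v w; have [[x ->] [y ->] [z ->]] := And3 (rhoP u) (rhoP v) (rhoP w).
  by rewrite -raddfD !mulE mulrDr raddfD.
have scaleAl c u v : c *: mul u v = mul (c *: u) v.
  have [[x ->] [y ->]] := conj (rhoP u) (rhoP v).
  by rewrite mulE -!rhoZ mulE -scalerAl.
have scaleAr c u v : c *: mul u v = mul u (c *: v).
  have [[x ->] [y ->]] := conj (rhoP u) (rhoP v).
  by rewrite mulE -!rhoZ mulE -scalerAr.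
have one_neq0 : rho 1 != 0.
  have [v] := V_neq0; apply: contra_neq => rho1.
  by rewrite -[v]mul1 rho1 -(raddf0 rho) -[v]rhoK mulE mul0r raddf0.
pose law := AlgLaw mulA mul1 mulr1 mulDl mulDr scaleAl scaleAr one_neq0.
have rhoA : zmod_morphism (rho : B -> law_alg law) by exact: raddfB.
have rhoMM : monoid_morphism (rho : B -> law_alg law) by split=> // x y; rewrite -mulE.
pose rA := GRing.isZmodMorphism.Build B (law_alg law) (rho : B -> law_alg law) rhoA.
pose rM := GRing.isMonoidMorphism.Build B (law_alg law) (rho : B -> law_alg law) rhoMM.
by exists law, (HB.pack_for {rmorphism B -> law_alg law} (rho : B -> law_alg law) rA rM).
Qed.

End LawAlongSurjection.

Section LawOnRows.
Variables (F : fieldType) (n : nat) (law : alg_law 'rV[F]_n).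

(** [law_alg law], under a name of its own to carry the additional structure of a
finite-dimensional algebra. *)
Definition row_alg : Type := law_alg law.
HB.instance Definition _ := GRing.Algebra.on row_alg.
HB.instance Definition _ := Vector.copy row_alg 'rV[F]_n.
HB.instance Definition _ := Algebra_isFalgebra.Build F row_alg.

Lemma row_alg_basis : is_basis (fun i : 'I_n => delta_mx 0 i : row_alg).
Proof.
have comb (r : 'rV[F]_n) :
    \sum_i r 0 i *: (delta_mx 0 i : row_alg) = r by rewrite [RHS]row_sum_delta.
by apply: is_basis_ord => [r|x]; [rewrite comb | exists x; rewrite comb].
Qed.

End LawOnRows.

Section Reduction.
Variables (F : fieldType) (B : algType {fps F}) (n : nat) (b : 'I_n -> B).
Hypothesis b_basis : is_basis b.

(** Reduction of the coordinates modulo [t].  Its kernel [t B] is an ideal, which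
makes the product of [B] descend to rows over [F]. *)
Lemma reduction_mod_t : exists (law : alg_law 'rV[F]_n)
    (rho : {rmorphism B -> row_alg law}),
  [/\ forall i, rho (b i) = delta_mx 0 i,
      forall a x, rho (a *: x) = fcoef a 0 *: rho x,
      forall x, rho x = 0 -> exists y, x = 't *: y
    & forall u, exists x, rho x = u].
Proof.
have [kappa [kappaK bE]] := basis_coord b_basis.
pose r x : 'rV[F]_n := map_mx (fun a => fcoef a 0) (kappa x).
pose s (u : 'rV[F]_n) := \sum_i fpsC (u 0 i) *: b i.
have rL : zmod_morphism r.
  by move=> x y; apply/rowP => i; rewrite !mxE linearB !mxE.
pose rho : {additive B -> 'rV[F]_n} :=
  HB.pack_for {additive B -> 'rV[F]_n} r (GRing.isZmodMorphism.Build B 'rV[F]_n r rL).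
have rZ a x : rho (a *: x) = fcoef a 0 *: rho x.
  apply/rowP => i; rewrite !mxE linearZ !mxE.
  by rewrite fcoefM big_ord_recl big_ord0 addr0.
have rb (a : 'rV[{fps F}]_n) : rho (\sum_i a 0 i *: b i) = map_mx (fun a => fcoef a 0) a.
  by rewrite /= /r kappaK.
have sK : cancel s rho.
  move=> u; have -> : s u = \sum_i (map_mx (@fpsC F) u) 0 i *: b i.
    by apply: eq_bigr => i _; rewrite mxE.
  by rewrite rb; apply/rowP => i; rewrite !mxE.
have ker x : rho x = 0 -> exists y, x = 't *: y.
  move=> /rowP x0; exists (\sum_i Fps (fun k => fcoef (kappa x 0 i) k.+1) *: b i).
  rewrite [LHS]bE scaler_sumr; apply: eq_bigr => i _; rewrite scalerA.
  have := x0 i; rewrite !mxE [in RHS]/= {2}(fps_split (kappa x 0 i)) => ->.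
  by rewrite raddf0 add0r.
have r0 y : rho ('t *: y) = 0 by rewrite rZ /= scale0r.
have red x : exists y, x = s (rho x) + 't *: y.
  have [|y yE] := ker (x - s (rho x)); first by rewrite raddfB sK subrr.
  by exists y; rewrite -yE addrC subrK.
have rM x y : rho (x * y) = rho (s (rho x) * s (rho y)).
  have [x' {1}->] := red x; have [y' {1}->] := red y.
  by rewrite mulrDl mulrDr -addrA -scalerAl -scalerAr -scalerDr raddfD r0 addr0.
have rZ' c x : rho (fpsC c *: x) = c *: rho x by rewrite rZ.
have rbE i : rho (b i) = delta_mx 0 i.
  rewrite -(delta_comb b i) rb; apply/rowP => k; rewrite !mxE.
  by case: (_ && _); rewrite /= ?fcoef1.
have V0 : exists v : 'rV[F]_n, v != 0.
  exists (delta_mx 0 (Ordinal (basis_size_gt0 b_basis))).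
  apply/eqP => /rowP /(_ (Ordinal (basis_size_gt0 b_basis))).
  by rewrite !mxE !eqxx => /eqP; rewrite oner_eq0.
have [law [rho' rho'E]] := law_along_surjection sK rZ' rM V0.
exists law, rho'; split=> [i|a x|x|u].
- by rewrite rho'E.
- by rewrite !rho'E rZ.
- by rewrite rho'E => /ker.
- by exists (s u); rewrite rho'E sK.
Qed.

End Reduction.

Section LinearSection.
Variables (F : fieldType) (N : falgType F) (B : algType {fps F}).
Variable rho : {rmorphism B -> N}.
Hypotheses (rhoZ : forall a x, rho (a *: x) = fcoef a 0 *: rho x)
  (rho_ker : forall x, rho x = 0 -> exists y, x = 't *: y)
  (rho_surj : forall u, exists x, rho x = u).

(** A section [s0] obtained by lifting a basis sends 1 to some lift of 1 only.  As
[1 - s0 1] is in the kernel of [rho], a multiple of it may be added to [s0]; the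
multiple is a linear functional taking the value 1 at the identity, namely a
rescaled coordinate that does not vanish there. *)
Lemma unital_linear_section : exists s : {additive N -> B},
  [/\ forall c u, s (c *: u) = fpsC c *: s u, cancel s rho & s 1 = 1].
Proof.
pose e := vbasis {:N}.
have /choice [y yE] : forall i : 'I_(\dim {:N}), exists x, rho x = e`_i.
  by move=> i; apply: rho_surj.
pose s0 u := \sum_i fpsC (coord e i u) *: y i.
have s0K u : rho (s0 u) = u.
  rewrite rmorph_sum {2}(coord_vbasis (memvf u)); apply: eq_bigr => i _.
  by rewrite rhoZ yE.
have s0B u v : s0 (u - v) = s0 u - s0 v.
  rewrite /s0 -sumrB; apply: eq_bigr => i _.
  by rewrite linearB raddfB /= scalerBl.
have s0Z c u : s0 (c *: u) = fpsC c *: s0 u.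
  rewrite /s0 scaler_sumr; apply: eq_bigr => i _.
  by rewrite linearZ rmorphM scalerA.
have [i i1] : exists i, coord e i 1 != 0.
  apply/existsP; apply: contraT; rewrite negb_exists => /forallP e0.
  have /eqP := coord_vbasis (memvf (1 : N)); rewrite big1 ?oner_eq0 // => i _.
  by have := e0 i; rewrite negbK => /eqP ->; rewrite scale0r.
pose s u := s0 u + fpsC (coord e i u / coord e i 1) *: (1 - s0 1).
have sB : zmod_morphism s.
  move=> u v; rewrite /s s0B [coord e i _]linearB mulrBl (raddfB (@fpsC F)) scalerBl.
  by rewrite opprD addrACA.
exists (HB.pack_for {additive N -> B} s (GRing.isZmodMorphism.Build N B s sB)).
split=> [c u|u|] /=.
- by rewrite /s s0Z [coord e i _]linearZ -mulrA rmorphM [RHS]scalerDr scalerA.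
- by rewrite rmorphD s0K rhoZ rmorphB rmorph1 s0K subrr scaler0 addr0.
- by rewrite /s divff // rmorph1 scale1r addrC subrK.
Qed.

(** [pi_t] and [rho] have the same kernel, so composing [pi_t] with any section of
[rho] gives the isomorphism induced by [rho]. *)
Lemma deformation_of_reduction :
  exists (g : {rmorphism N -> quot_t B}) (s : {additive N -> B}),
    [/\ bijective g, forall (c : F) x, g (c *: x) = c *: g x,
        forall (c : F) x, s (c *: x) = fpsC c *: s x,
        forall x, pi_t (s x) = g x & s 1 = 1].
Proof.
have [s [sZ sK s1]] := unital_linear_section.
have rho_t y : rho ('t *: y) = 0 by rewrite rhoZ scale0r.
have piE x x' : rho x = rho x' <-> pi_t x = pi_t x'.
  rewrite pi_tP; split=> [e|[z e]]; first by apply: rho_ker; rewrite rmorphB e subrr.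
  by apply/eqP; rewrite -subr_eq0 -rmorphB e rho_t.
pose g u : quot_t B := pi_t (s u).
have gB : zmod_morphism g by move=> u v; rewrite /g !raddfB.
have gM : monoid_morphism g.
  split=> [|u v]; first by rewrite /g s1.
  rewrite /g -[RHS]/(quot_t_mul _ _) pi_tM; apply/piE.
  by rewrite rmorphM !sK.
pose gA := GRing.isZmodMorphism.Build N (quot_t B) g gB.
pose gMM := GRing.isMonoidMorphism.Build N (quot_t B) g gM.
exists (HB.pack_for {rmorphism N -> quot_t B} g gA gMM), s; split=> //=.
  exists (fun v : quot_t B => rho (repr v)) => u.
    by rewrite -[RHS]sK; apply/piE; rewrite pi_t_repr.
  by rewrite -[RHS]pi_t_repr /g; apply/piE; rewrite sK.
by move=> c u; rewrite -[RHS]/(quot_t_scale _ _) /g sZ pi_tZ.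
Qed.

End LinearSection.

(** * Power series over a module *)

Section PowerSeriesBasis.
Variables (F : comNzRingType) (N : lmodType F) (n : nat) (d : 'I_n -> N).

Lemma fcoef_comb (a : 'rV[{fps F}]_n) k :
  fcoef (\sum_i a 0 i *: fpsC (d i)) k = \sum_i fcoef (a 0 i) k *: d i.
Proof.
rewrite (big_morph (fun p => fcoef p k) (id1 := 0) (op1 := +%R)) //.
apply: eq_bigr => i _; apply: conv_deltar => // u; exact: scaler0.
Qed.

Lemma fpsC_basis : is_basis d -> is_basis (fun i => fpsC (d i)).
Proof.
move=> /basis_coord [kappa [kappaK dE]]; apply: is_basis_ord => [r r0|p].
  apply/rowP => i; apply/fpsP => k; rewrite mxE.
  have := fcoef_comb r k; rewrite r0 fcoef0 => /esym /(congr1 kappa).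
  have -> : \sum_i fcoef (r 0 i) k *: d i = \sum_i (map_mx (fun a => fcoef a k) r) 0 i *: d i.
    by apply: eq_bigr => l _; rewrite mxE.
  by rewrite kappaK linear0 => /rowP /(_ i); rewrite !mxE.
exists (\row_i Fps (fun k => kappa (fcoef p k) 0 i)); apply/fpsP => k.
by rewrite fcoef_comb [LHS]dE; apply: eq_bigr => i _; rewrite mxE.
Qed.

End PowerSeriesBasis.

(** * Tensor products and bases *)

Section PureTensors.
Variables (R K : comNzRingType) (j : {rmorphism R -> K}) (B : algType R).
Implicit Types (x y : B) (k l : K).
Local Notation pure := (@pure_tensor R K j B).

(** The universal property of the tensor product. *)
Lemma tensor_lift (V : zmodType) (phi : B -> K -> V) : balanced j phi ->
  exists Phi : {additive tensor j B -> V}, forall x k, Phi (pure x k) = phi x k.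
Proof.
move=> phiB; pose Phi (u : tensor j B) := balanced_sum phi (repr u).
have PhiE s : Phi (tsum j s) = balanced_sum phi s.
  by have /tsumP e := tsum_repr (tsum j s); apply: e.
have PhiD : zmod_morphism Phi.
  move=> u v; rewrite -[u]tsum_repr -[v]tsum_repr.
  rewrite -[- tsum j (repr v)]/(tensor_opp _) tsumN tsum_cat !PhiE.
  by rewrite balanced_sum_cat (balanced_sum_opp phiB).
pose PhiA := GRing.isZmodMorphism.Build (tensor j B) V Phi PhiD.
exists (HB.pack_for {additive tensor j B -> V} Phi PhiA) => x k.
by rewrite /= PhiE /balanced_sum big_seq1.
Qed.

Lemma pure_tensorM x y k l : pure x k * pure y l = pure (x * y) (k * l).
Proof. exact: tsumM. Qed.

Lemma pure_tensorZ k x l : k *: pure x l = pure x (k * l).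
Proof. exact: tsumZ. Qed.

Lemma balanced_pure_tensor : balanced j pure.
Proof.
split=> [k x y|x k l|a x k]; rewrite ?tsum_cat; apply/tsumP => V phi [Dl Dr S].
- by rewrite /balanced_sum !big_cons !big_nil !addr0 Dl.
- by rewrite /balanced_sum !big_cons !big_nil !addr0 Dr.
- by rewrite /balanced_sum !big_seq1 S.
Qed.

Lemma tensorE (u : tensor j B) :
  exists s : seq (B * K), u = \sum_(p <- s) pure p.1 p.2.
Proof.
rewrite -[u]tsum_repr; exists (repr u); elim: (repr u) => [|p s IHs].
  by rewrite big_nil.
by rewrite big_cons -IHs tsum_cat; case: p.
Qed.

(** Extension of scalars preserves bases: the coordinates over [R] induce, by the
universal property, coordinates over [K]. *)
Lemma tensor_coord n (b : 'I_n -> B) : is_basis b ->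
  exists (kappa : {linear B -> 'rV[R]_n}) (kappaK : {additive tensor j B -> 'rV[K]_n}),
  [/\ injective kappa,
      forall x k, kappaK (pure x k) = k *: map_mx j (kappa x),
      forall r : 'rV[K]_n, kappaK (\sum_i pure (b i) (r 0 i)) = r
    & forall u, u = \sum_i pure (b i) (kappaK u 0 i)].
Proof.
move=> /basis_coord [kappa [kappa_b bE]].
have [Dl Dr S] := balanced_pure_tensor.
have [|kK kKE] := @tensor_lift _ (fun x k => k *: map_mx j (kappa x)).
  split=> [k x y|x k l|a x k] /=; first by rewrite raddfD map_mxD scalerDr.
    by rewrite scalerDl.
  by rewrite linearZ map_mxZ scalerA mulrC.
have pure0l k : pure 0 k = 0 by exact: (balanced0l balanced_pure_tensor).
have pure_comb k (r : 'rV[R]_n) : pure (\sum_i r 0 i *: b i) k =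
    \sum_i pure (b i) (j (r 0 i) * k).
  rewrite (big_morph (pure^~ k) (Dl k) (pure0l k)).
  by apply: eq_bigr => i _; rewrite S.
have kb i : kappa (b i) = delta_mx 0 i.
  by rewrite -(delta_comb b i) kappa_b.
exists kappa, kK; split=> // [x y xy|r|u].
- by rewrite [x]bE [y]bE xy.
- rewrite raddf_sum [RHS]row_sum_delta; apply: eq_bigr => i _.
  by rewrite kKE kb map_delta_mx.
have [s ->] := tensorE u; rewrite raddf_sum.
under [RHS]eq_bigr do rewrite summxE.
have sumr i (a : B * K -> K) : pure (b i) (\sum_(p <- s) a p) = \sum_(p <- s) pure (b i) (a p).
  apply: (big_morph (pure (b i)) (Dr (b i))).
  by apply: (addrI (pure (b i) 0)); rewrite -Dr !addr0.
under [RHS]eq_bigr do rewrite sumr.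
rewrite exchange_big; apply: eq_bigr => p _.
rewrite {1}[p.1]bE pure_comb; apply: eq_bigr => i _.
by rewrite kKE !mxE mulrC.
Qed.

End PureTensors.

Section TensorIso.
Variables (F : comNzRingType) (O : idomainType) (K : fieldType).
Variables (iota : F -> O) (jF : {rmorphism F -> K}) (jO : {rmorphism O -> K}).
Variables (A : algType F) (B : algType O) (n : nat) (e : 'I_n -> A) (b : 'I_n -> B).
Variables (tau : {additive A -> B}) (delta : O).
Hypotheses (jOF : forall c, jO (iota c) = jF c) (jO_inj : injective jO)
  (e_basis : is_basis e) (b_basis : is_basis b) (delta_neq0 : delta != 0)
  (tauZ : forall c a, tau (c *: a) = iota c *: tau a)
  (tauM : forall a a', tau a * tau a' = delta *: tau (a * a'))
  (tau1 : tau 1 = delta *: 1)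
  (tau_indep : lin_indep (tau \o e)).

(** Here [tau] stands for multiplication by [delta], seen as a map from [A] to [B].
The map [a (x) k |-> tau a (x) k / delta] respects products because the
factors [delta] cancel; its matrix in the bases is, up to the factor
[1 / delta], that of [tau], which is invertible over [K] since [tau] maps the
basis of [A] to independent elements.  The isomorphism in the statement is the
inverse of this map. *)
Lemma tensor_iso_of_multiple :
  exists g : {rmorphism tensor jO B -> tensor jF A},
    bijective g /\ forall (c : K) x, g (c *: x) = c *: g x.
Proof.
have d0 : jO delta != 0 by rewrite -(rmorph0 jO) (inj_eq jO_inj).
have [DlB DrB SB] := balanced_pure_tensor jO B.
have [|Psi PsiE] := @tensor_lift _ _ jF A _
    (fun a k => pure_tensor jO (tau a) ((jO delta)^-1 * k)).
  split=> [k a a'|a k l|c a k] /=; first by rewrite raddfD DlB.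
    by rewrite mulrDr DrB.
  by rewrite tauZ SB jOF mulrCA.
have PsiZ c u : Psi (c *: u) = c *: Psi u.
  have [s ->] := tensorE u; rewrite scaler_sumr !(raddf_sum Psi) scaler_sumr.
  by apply: eq_bigr => p _; rewrite pure_tensorZ !PsiE pure_tensorZ mulrCA.
have PsiM : monoid_morphism Psi.
  split=> [|u v].
    by rewrite [LHS]PsiE tau1 SB mulr1 divff.
  have [s ->] := tensorE u; have [r ->] := tensorE v.
  rewrite mulr_suml !raddf_sum mulr_suml; apply: eq_bigr => p _.
  rewrite !mulr_sumr raddf_sum; apply: eq_bigr => q _.
  rewrite pure_tensorM !PsiE pure_tensorM tauM SB; congr pure_tensor.
  by rewrite -(mulrA (jO delta)^-1 p.2) mulVKf // mulrCA.
have [kA [kAK [_ _ kAKe uAE]]] := tensor_coord jF e_basis.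
have [kB [kBK [kB_inj kBKE kBKb uBE]]] := tensor_coord jO b_basis.
pose Q : 'M[O]_n := \matrix_i kB (tau (e i)).
have kPsi (r : 'rV[K]_n) : kBK (Psi (\sum_i pure_tensor jF (e i) (r 0 i)))
    = (jO delta)^-1 *: (r *m map_mx jO Q).
  rewrite !raddf_sum mulmx_sum_row scaler_sumr; apply: eq_bigr => i _.
  rewrite PsiE kBKE scalerA; congr (_ *: _).
  by apply/rowP => l; rewrite !mxE.
(* A relation between the rows of Q would be one between the elements tau (e i). *)
have Qu : map_mx jO Q \in unitmx.
  rewrite unitmxE unitfE det_map_mx -(rmorph0 jO) (inj_eq jO_inj).
  apply/negP => /det0P [r r0 rQ]; case/negP: r0; apply/eqP.
  move/lin_indep_ordP: tau_indep; apply.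
  apply: kB_inj; rewrite linear0 -rQ mulmx_sum_row linear_sum.
  by apply: eq_bigr => i _; rewrite linearZ /= rowK.
(* In coordinates Psi is r |-> delta^-1 *: (r *m Q), and h is its inverse. *)
pose h (u : tensor jO B) : tensor jF A :=
  \sum_i pure_tensor jF (e i) ((jO delta *: (kBK u *m invmx (map_mx jO Q))) 0 i).
have hK : cancel h Psi.
  move=> u; rewrite [RHS]uBE [LHS]uBE kPsi -scalemxAl scalerA mulVf // scale1r.
  by rewrite mulmxKV.
have PsiK : cancel Psi h.
  move=> u; rewrite /h [in LHS](uAE u) kPsi -scalemxAl scalerA divff // scale1r.
  by rewrite mulmxK // -uAE.
pose P u := Psi u.
pose PA := GRing.isZmodMorphism.Build (tensor jF A) (tensor jO B) P (raddfB Psi).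
pose PM := GRing.isMonoidMorphism.Build (tensor jF A) (tensor jO B) P PsiM.
pose Psi' := HB.pack_for {rmorphism tensor jF A -> tensor jO B} P PA PM.
have Psi'_bij : bijective Psi' by exists h.
have [g [gK Kg]] := rmorphism_inverse Psi'_bij.
exists g; split=> [|c x]; first by exists Psi'.
by apply: (can_inj gK); rewrite Kg [RHS]PsiZ -[Psi (g x)]/(Psi' (g x)) Kg.
Qed.

End TensorIso.

(** * The flat deformation given by a basis *)

(** What is claimed of the structure constants [zeta + t xi] of [B], under a name
because it is proved for an abstract [B] before [B] becomes an image. *)
Definition flat_family (F : fieldType) (A : falgType F) (B : algType {fps F}) n
    (zeta : 'I_n -> 'I_n -> 'I_n -> F)
    (xi : 'I_n -> 'I_n -> 'I_n -> {fps F}) : Prop :=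
  exists (N : falgType F) (d : 'I_n -> N),
  [/\ is_basis d,
      forall k m, d k * d m = \sum_i zeta i k m *: d i,
      alg_isomorphic F N (quot_t B)
    & exists star : alg_law {fps N},
      [/\ is_basis (fun i => fpsC (d i)),
          forall k m, star (fpsC (d k)) (fpsC (d m)) =
            \sum_i (fpsC (zeta i k m) + 't * xi i k m) *: fpsC (d i),
          formal_deformation star,
          alg_isomorphic {fps F} (law_alg star) B
        & flat_deformation N A (law_alg star)]].

Section FlatDeformation.
Variables (F : fieldType) (A : falgType F) (B : algType {fps F}) (n : nat).
Variables (e : 'I_n -> A) (b : 'I_n -> B) (tau : {additive A -> B}) (delta : {fps F}).
Hypotheses (e_basis : is_basis e) (b_basis : is_basis b) (delta_neq0 : delta != 0)
  (tauZ : forall c a, tau (c *: a) = fpsC c *: tau a)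
  (tauM : forall a a', tau a * tau a' = delta *: tau (a * a'))
  (tau1 : tau 1 = delta *: 1)
  (tau_indep : lin_indep (tau \o e)).
Variables (zeta : 'I_n -> 'I_n -> 'I_n -> F) (xi : 'I_n -> 'I_n -> 'I_n -> {fps F}).
Hypothesis bM : forall k m,
  b k * b m = \sum_i (fpsC (zeta i k m) + 't * xi i k m) *: b i.

(** [N] is the reduction of [B], with basis the images of the [b i], and [star] is
the product of [B] carried to [{fps N}].  Composing the reduction with this
identification shows [N] to be the reduction of [law_alg star] as well. *)
Lemma flat_deformation_of_basis : flat_family A B zeta xi.
Proof.
have [law [rho [rho_b rhoZ rho_ker rho_surj]]] := reduction_mod_t b_basis.
pose N : falgType F := row_alg law.
pose d i : N := delta_mx 0 i.
have d_basis : is_basis d by exact: row_alg_basis.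
have D_basis := fpsC_basis d_basis.
exists N, d; split=> //.
- move=> k m; rewrite /d -!rho_b -rmorphM bM rmorph_sum; apply: eq_bigr => i _.
  by rewrite rhoZ fcoefD fcoef_tM0 addr0 rho_b.
- have [g [s [gB gZ _ _ _]]] := deformation_of_reduction rhoZ rho_ker rho_surj.
  by exists g; split.
have [kB [kBb bE]] := basis_coord b_basis.
have [kD [kDd DE]] := basis_coord D_basis.
(* th is the O-linear bijection from B to {fps N} that matches the bases. *)
pose th x : {fps N} := \sum_i kB x 0 i *: fpsC (d i).
pose ht p : B := \sum_i kD p 0 i *: b i.
have thK : cancel th ht by move=> x; rewrite /ht kDd -bE.
have htK : cancel ht th by move=> p; rewrite /th kBb -DE.
have thL : linear th.
  move=> a x y; rewrite /th scaler_sumr -big_split; apply: eq_bigr => i _.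
  by rewrite linearP !mxE scalerDl scalerA.
have th_comb (r : 'rV[{fps F}]_n) : th (\sum_i r 0 i *: b i) = \sum_i r 0 i *: fpsC (d i).
  by rewrite /th kBb.
pose theta : {linear B -> {fps N}} :=
  HB.pack_for {linear B -> {fps N}} th
    (GRing.isLinear.Build {fps F} B {fps N} *:%R th thL).
have thZ c x : theta (id c *: x) = c *: theta x by rewrite linearZ.
have thM x y : theta (x * y) = theta (ht (theta x) * ht (theta y)) by rewrite /= !thK.
have fpsN_neq0 : exists p : {fps N}, p != 0.
  exists (fpsC 1); apply/eqP => /(congr1 (fun p => fcoef p 0)) /eqP.
  by rewrite /= oner_eq0.
have [star [theta' theta'E]] :=
  @law_along_surjection {fps F} {fps F} B {fps N} id theta ht htK thZ thM fpsN_neq0.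
have theta'_bij : bijective theta' by exists ht => x; rewrite theta'E /= ?thK ?htK.
have theta'Z c x : theta' (c *: x) = c *: theta' x.
  by rewrite !theta'E; apply: thZ.
have [back [thetaK backK]] := rmorphism_inverse theta'_bij.
have backZ c (x : law_alg star) : back (c *: x) = c *: back x.
  by apply: (can_inj thetaK); rewrite backK theta'Z backK.
have theta'b i : theta' (b i) = fpsC (d i).
  by rewrite theta'E /= -(delta_comb b i) th_comb (delta_comb (fun i => fpsC (d i))).
have rho_backZ a (x : law_alg star) : (rho \o back) (a *: x) = fcoef a 0 *: (rho \o back) x.
  by rewrite /= backZ rhoZ.
have rho_back_ker x : (rho \o back) x = 0 -> exists y, x = 't *: y.
  move=> /rho_ker [y yE]; exists (theta' y); apply: (can_inj backK).
  by rewrite backZ thetaK.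
have rho_back_surj u : exists x, (rho \o back) x = u.
  by have [x <-] := rho_surj u; exists (theta' x); rewrite /= thetaK.
have [g [s [g_bij gZ sZ sg s1]]] := @deformation_of_reduction F N (law_alg star)
  (rho \o back) rho_backZ rho_back_ker rho_back_surj.
exists star; split=> //.
- move=> k m; rewrite -!theta'b -[star _ _]/((theta' (b k) : law_alg star) * theta' (b m)).
  rewrite -rmorphM bM rmorph_sum; apply: eq_bigr => i _.
  by rewrite theta'Z theta'b.
- by exists g; split.
- by exists back; split; first exists theta'.
split; first split.
- by exists ('I_n : eqType), (fun i => fpsC (d i)).
- by exists g, s; split.
move=> K j _.
have tau'Z c a : (theta' \o tau) (c *: a) = fpsC c *: (theta' \o tau) a.
  by rewrite /= tauZ theta'Z.
have tau'M a a' : (theta' \o tau) a * (theta' \o tau) a' = delta *: (theta' \o tau) (a * a').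
  by rewrite /= -rmorphM tauM theta'Z.
have tau'1 : (theta' \o tau) 1 = delta *: 1.
  by rewrite /= tau1 theta'Z rmorph1.
have tau'_indep : lin_indep ((theta' \o tau) \o e).
  move: tau_indep; rewrite !lin_indep_ordP => tI r r0; apply: tI.
  apply: (can_inj thetaK); rewrite rmorph0 -r0 rmorph_sum.
  by apply: eq_bigr => i _; rewrite theta'Z.
have j_inj : injective (j \o @tofrac {fps F}).
  by move=> x y /= /fmorph_inj /eqP; rewrite tofrac_eq => /eqP.
exact: (@tensor_iso_of_multiple F {fps F} K (@fpsC F) _ _ A (law_alg star) n e
  (fun i => fpsC (d i)) (theta' \o tau) delta).
Qed.

End FlatDeformation.

(** * Laurent series *)

Section LaurentCoordinates.
Variables (F : comNzRingType) (A : algType F).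
Implicit Types (a : {fps F}) (x : {laurent A}) (u v : A).

(** Truncating [t^m x] at its nonnegative part is linear on the elements whose pole
has order at most [m], but not on all Laurent series. *)
Lemma scale_laurentE m a x : pole_le m x ->
  a *: x = laurent_of m (a *: fps_of m x).
Proof.
move=> xm; rewrite -[LHS]/(laurent_inj A a * x).
rewrite (laurentM (pole_le_laurent_of 0 _) xm) add0n laurent_ofK.
congr laurent_of; apply/fpsP => i; rewrite fcoefM fcoefZ.
by apply: eq_bigr => k _; rewrite /= -scalerAl mul1r.
Qed.

Lemma pole_leZ m a x : pole_le m x -> pole_le m (a *: x).
Proof. by move=> xm; rewrite (scale_laurentE a xm); apply: pole_le_laurent_of. Qed.

Lemma fps_ofZ m a x : pole_le m x -> fps_of m (a *: x) = a *: fps_of m x.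
Proof. by move=> xm; rewrite (scale_laurentE a xm) laurent_ofK. Qed.

Definition laurentC u : {laurent A} := laurent_of 0 (fpsC u).

Lemma pole_laurentC m u : pole_le m (laurentC u).
Proof. exact: pole_leW (leq0n m) (pole_le_laurent_of 0 _). Qed.

Lemma laurentC_zmod_morphism : zmod_morphism laurentC.
Proof.
move=> u v; apply/laurentP => i; rewrite lcoefB /= /fps_div.
by case: (i + 0) => k /=; [case: ifP |]; rewrite ?subr0.
Qed.
HB.instance Definition _ :=
  GRing.isZmodMorphism.Build A {laurent A} laurentC laurentC_zmod_morphism.

Lemma laurentC_monoid_morphism : monoid_morphism laurentC.
Proof.
split=> // u v; rewrite (laurentM (@pole_laurentC 0 u) (@pole_laurentC 0 v)).
by rewrite !laurent_ofK -rmorphM.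
Qed.
HB.instance Definition _ :=
  GRing.isMonoidMorphism.Build A {laurent A} laurentC laurentC_monoid_morphism.

Lemma laurentCZ (c : F) u : laurentC (c *: u) = fpsC c *: laurentC u.
Proof.
rewrite (scale_laurentE _ (@pole_laurentC 0 u)) laurent_ofK; congr laurent_of.
apply/fpsP => i; rewrite fcoefZ big_ord_recl big1 => [|k _]; last exact: scale0r.
by rewrite addr0 subn0 /=; case: ifP; rewrite ?scaler0.
Qed.

Lemma laurentC_indep n (e : 'I_n -> A) : is_basis e -> lin_indep (laurentC \o e).
Proof.
move=> /fpsC_basis [/lin_indep_ordP eI _]; apply/lin_indep_ordP => r r0.
apply: eI; transitivity (fps_of 0 (\sum_i r 0 i *: laurentC (e i))); last by rewrite r0.
rewrite (big_morph (fps_of 0) (id1 := 0) (op1 := +%R)) //.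
by apply: eq_bigr => i _; rewrite fps_ofZ ?laurent_ofK //; apply: pole_laurentC.
Qed.

End LaurentCoordinates.

(** * Noncommutative polynomials *)

Section FreeAlgebra.
Variables (F : comNzRingType) (rho : nat).

(** The coefficient map of [free_const], written as a composition of additive maps
so that the results on [mmap] apply to it. *)
Lemma free_constE (c : free_alg F rho) : free_const c =
  mmap (@malgC {fmonom 'I_rho} {fps F} \o @fpsC F) (fun v => << v >>) c.
Proof. by []. Qed.

Lemma free_const_word (w : {fmonom 'I_rho}) :
  free_const (<< w >> : free_alg F rho) = << w >>.
Proof. by rewrite free_constE mmapU /= rmorph1 mul_malgC scale1r. Qed.

Lemma free_polyC (c : free_alg F rho) : free_poly c%:P = free_const c.
Proof.
rewrite /free_poly size_polyC; have [->|c0] := eqVneq c 0.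
  by rewrite big_ord0 free_constE raddf0.
by rewrite big_ord_recl big_ord0 addr0 expr0 scale1r coefC.
Qed.

Lemma free_const_span (w : free_alg {fps F} rho) :
  exists s : seq ({fps F} * free_alg F rho), w = \sum_(p <- s) p.1 *: free_const p.2.
Proof.
exists [seq (w@_m, << m >>) | m <- finmap.enum_fset (msupp w)].
rewrite big_map [LHS]monalgE; apply: eq_bigr => m _ /=.
by rewrite free_const_word; apply/malgP => k; rewrite mcoeffZ !mcoeffU mulrnAr mulr1.
Qed.

End FreeAlgebra.

(** * The image of a morphism with bounded poles *)

Section ImageEmbedding.
Variables (R : comNzRingType) (B : lalgType R) (D : algType R).
Variable f : {lrmorphism B -> D}.

Lemma im_val_linear : linear (@im_val R B D f). Proof. exact: (linearP \val). Qed.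
HB.instance Definition _ :=
  GRing.isLinear.Build R (im_alg f) D *:%R (@im_val R B D f) im_val_linear.

Lemma im_val_monoid_morphism : monoid_morphism (@im_val R B D f).
Proof. by split=> [|x y]; [exact: (rmorph1 \val) | exact: (rmorphM \val)]. Qed.
HB.instance Definition _ := GRing.isMonoidMorphism.Build (im_alg f) D
  (@im_val R B D f) im_val_monoid_morphism.

Lemma im_val_inj : injective (@im_val R B D f). Proof. exact: val_inj. Qed.

Lemma im_val_comb n (a : 'I_n -> R) (b : 'I_n -> im_alg f) :
  im_val (\sum_i a i *: b i) = \sum_i a i *: im_val (b i).
Proof. by rewrite linear_sum; apply: eq_bigr => i _; rewrite linearZ. Qed.

End ImageEmbedding.

Section ImageLattice.
Variables (F : fieldType) (A : falgType F) (B : lalgType {fps F}).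
Variables (f : {lrmorphism B -> {laurent A}}) (gamma : nat).
Hypothesis f_pole : forall w, pole_le gamma (f w).
Local Notation n := (\dim {:A}).
Local Notation M := (im_alg f).

Lemma im_alg_pole (y : M) : pole_le gamma (im_val y).
Proof. by have /asboolP [w <-] := im_valP y. Qed.

(** Multiplication by [t^gamma] embeds the image of [f] into [A{t}], which is free
over the power series with the same basis as [A]. *)
Lemma laurent_coord : exists (kappaA : {linear {fps A} -> 'rV[{fps F}]_n})
    (kappa : {linear M -> 'rV[{fps F}]_n}),
  [/\ injective kappaA, injective kappa
    & forall y, kappa y = kappaA (fps_of gamma (im_val y))].
Proof.
have [kA [_ kAE]] := basis_coord (fpsC_basis (vbasis_is_basis A)).
pose k (y : M) := kA (fps_of gamma (im_val y)).
have kL : linear k.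
  move=> a x y; rewrite /k linearP.
  by rewrite fps_ofD (fps_ofZ _ (im_alg_pole x)) linearP.
exists kA, (HB.pack_for {linear M -> 'rV[{fps F}]_n} k
  (GRing.isLinear.Build {fps F} M 'rV[{fps F}]_n *:%R k kL)).
have kA_inj : injective kA by move=> x y xy; rewrite [x]kAE [y]kAE xy.
split=> // x y /kA_inj xy; apply: val_inj.
by apply: laurent_of_inj xy; apply: im_alg_pole.
Qed.

(** With [P] the coordinate matrix of the basis, [\det P *: u = u *m \adj P *m P]
is a combination of the rows of [P] for every row [u]; hence [delta = \det P]. *)
Lemma multiple_in_image (b : 'I_n -> M) : is_basis b ->
  exists2 delta : {fps F}, delta != 0 &
    forall a : A, exists y : M, im_val y = delta *: laurentC a.
Proof.
move=> [b_indep _]; have [kA [k [kA_inj k_inj kE]]] := laurent_coord.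
have /(lin_indep_det b k_inj id) := b_indep.
set P := \matrix_i _ => P0; exists (\det P) => // a.
pose r := kA (fps_of gamma (laurentC a)) *m \adj P.
exists (\sum_i r 0 i *: b i).
apply: (@laurent_of_inj _ gamma); first exact: im_alg_pole.
  exact: pole_leZ (@pole_laurentC _ _ gamma a).
apply: kA_inj; rewrite -kE (fps_ofZ _ (@pole_laurentC _ _ gamma a)) linearZ /=.
by rewrite (kappa_comb k b id) -mulmxA mul_adj_mx mul_mx_scalar.
Qed.

Lemma multiple_map (b : 'I_n -> M) : is_basis b ->
  exists (delta : {fps F}) (tau : {additive A -> M}), delta != 0 /\
    forall a, im_val (tau a) = delta *: laurentC a.
Proof.
move=> /multiple_in_image [delta d0 /choice [t tE]].
have tB : zmod_morphism t.
  by move=> u v; apply: im_val_inj; rewrite raddfB /= !tE rmorphB scalerBr.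
exists delta, (HB.pack_for {additive A -> M} t
  (GRing.isZmodMorphism.Build A M t tB)).
by [].
Qed.

(** The spanning family is given as elements [v i] of the Laurent series, in the
form in which the theorem mentions them, rather than as elements of the image. *)
Lemma image_flat_deformation (b : 'I_n -> M) (v : 'I_n -> {laurent A}) :
  is_basis b -> (forall i, v i = im_val (b i)) ->
  [/\ forall y, (exists w, f w = y) <->
        (exists a : 'I_n -> {fps F}, y = \sum_i a i *: v i),
      lin_indep v
    & exists (zeta : 'I_n -> 'I_n -> 'I_n -> F)
             (xi : 'I_n -> 'I_n -> 'I_n -> {fps F}),
      (forall k m, v k * v m =
         \sum_i (fpsC (zeta i k m) + 't * xi i k m) *: v i)
      /\ flat_family A M zeta xi].
Proof.
move=> b_basis vE; have [kappa [_ bE]] := basis_coord b_basis.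
have comb (a : 'I_n -> {fps F}) : \sum_i a i *: v i = im_val (\sum_i a i *: b i).
  by rewrite im_val_comb; apply: eq_bigr => i _; rewrite vE.
split.
- move=> y; split=> [yP|[a ->]]; last by rewrite comb; apply/asboolP/im_valP.
  by exists (kappa (ImAlg (asboolT yP)) 0); rewrite comb -bE.
- have /lin_indep_ordP bI := b_basis.1.
  apply/lin_indep_ordP => r; rewrite comb -(linear0 (@im_val _ _ _ f)).
  by move=> /im_val_inj; apply: bI.
have [delta [tau [delta_neq0 tauE]]] := multiple_map b_basis.
pose s i k m := kappa (b k * b m) 0 i.
pose zeta i k m := fcoef (s i k m) 0.
pose xi i k m := Fps (fun j => fcoef (s i k m) j.+1).
have bM k m : b k * b m = \sum_i (fpsC (zeta i k m) + 't * xi i k m) *: b i.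
  by under eq_bigr do rewrite -fps_split; apply: bE.
exists zeta, xi; split=> [k m|].
  by rewrite comb -bM !vE [RHS]rmorphM.
apply: (@flat_deformation_of_basis F A M n _ b tau delta
  (vbasis_is_basis A) b_basis delta_neq0 _ _ _ _ zeta xi bM).
- move=> a u; apply: im_val_inj; rewrite linearZ /= !tauE laurentCZ.
  by rewrite !scalerA mulrC.
- move=> u u'; apply: im_val_inj; rewrite linearZ rmorphM /= !tauE rmorphM.
  by rewrite -scalerAl -scalerAr.
- by apply: im_val_inj; rewrite linearZ rmorph1 /= tauE rmorph1.
apply/(lin_indep_linear _ (@im_val_inj _ _ _ f))/lin_indep_ordP => r r0.
have /lin_indep_ordP lI := laurentC_indep (vbasis_is_basis A).
have : delta *: r = 0.
  apply: lI; apply: etrans r0; apply: eq_bigr => i _ /=.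
  by rewrite tauE mxE mulrC scalerA.
move=> /rowP dr; apply/rowP => i; apply: (mulfI delta_neq0).
by have := dr i; rewrite !mxE mulr0.
Qed.

End ImageLattice.

(** * Images of noncommutative polynomials *)

Section Main.
Variables (F : fieldType) (rho : nat) (A : falgType F).
Local Notation n := (\dim {:A}).
Variables (f : {lrmorphism free_alg {fps F} rho -> {laurent A}}).
Hypotheses (f_indep : exists c : 'I_n -> free_alg F rho,
     lin_indep (fun i => f (free_const (c i))))
  (f_pole : exists gamma : nat, forall w, pole_le gamma (f w)).
Local Notation M := (im_alg f).

Definition im_const (c : free_alg F rho) : M :=
  ImAlg (asboolT (ex_intro _ (free_const c) erefl)).

(** Words have constant coefficients, and every noncommutative polynomial is a
combination of words; so the elements [im_const c] span the image. *)
Lemma im_const_basis : exists c : 'I_n -> free_alg F rho,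
  is_basis (im_const \o c).
Proof.
have [gamma poles] := f_pole.
have [_ [kappa [_ kappa_inj _]]] := laurent_coord poles.
apply: (min_order_basis kappa_inj).
  move=> [y yP]; have /asboolP [w wE] := yP.
  have [s sE] := free_const_span w.
  exists s; apply: im_val_inj; rewrite /= -wE sE !linear_sum.
  by apply: eq_bigr => p _; rewrite !linearZ.
have [c c_indep] := f_indep; exists c.
by apply/(lin_indep_linear _ (@im_val_inj _ _ _ f)).
Qed.

Lemma free_basis_and_flat_deformation :
  exists q : 'I_n -> {poly free_alg F rho},
    [/\ forall y, (exists w, f w = y) <->
          (exists a : 'I_n -> {fps F},
             y = \sum_i a i *: f (free_poly (q i))),
        lin_indep (fun i => f (free_poly (q i)))
      & exists (zeta : 'I_n -> 'I_n -> 'I_n -> F)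
               (xi : 'I_n -> 'I_n -> 'I_n -> {fps F}),
        (forall k m, f (free_poly (q k)) * f (free_poly (q m)) =
           \sum_i (fpsC (zeta i k m) + 't * xi i k m) *: f (free_poly (q i)))
        /\ flat_family A M zeta xi].
Proof.
have [c b_basis] := im_const_basis.
have [gamma poles] := f_pole; exists (fun i => (c i)%:P).
by apply: (image_flat_deformation poles b_basis) => i; rewrite free_polyC.
Qed.

End Main.

Theorem theorem8 (R : realType) (n rho : nat) (A : falgType R[i])
    (dimA : \dim {:A} = n)
    (f : {lrmorphism free_alg {fps R[i]} rho -> {laurent A}})
    (f_var : forall i : 'I_rho, is_laurent_poly (f (fvar {fps R[i]} i)))
    (f_indep : exists c : 'I_n -> free_alg R[i] rho,
       lin_indep (fun i => f (free_const (c i))))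
    (f_pole : exists gamma : nat, forall w, pole_le gamma (f w)) :
  exists q : 'I_n -> {poly free_alg R[i] rho},
    [/\ forall y, (exists w, f w = y) <->
          (exists a : 'I_n -> {fps R[i]},
             y = \sum_i a i *: f (free_poly (q i))),
        lin_indep (fun i => f (free_poly (q i)))
      & exists (zeta : 'I_n -> 'I_n -> 'I_n -> R[i])
               (xi : 'I_n -> 'I_n -> 'I_n -> {fps R[i]}),
        (forall k m, f (free_poly (q k)) * f (free_poly (q m)) =
           \sum_i (fpsC (zeta i k m) + 't * xi i k m) *: f (free_poly (q i)))
        /\
        exists (N : falgType R[i]) (d : 'I_n -> N),
          [/\ is_basis d,
              forall k m, d k * d m = \sum_i zeta i k m *: d i,
              alg_isomorphic R[i] N (quot_t (im_alg f))
            & exists star : alg_law {fps N},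
              [/\ is_basis (fun i => fpsC (d i)),
                  forall k m, star (fpsC (d k)) (fpsC (d m)) =
                    \sum_i (fpsC (zeta i k m) + 't * xi i k m) *: fpsC (d i),
                  formal_deformation star,
                  alg_isomorphic {fps R[i]} (law_alg star) (im_alg f)
                & flat_deformation N A (law_alg star)]]].
Proof.
subst n; exact: (@free_basis_and_flat_deformation R[i] rho A f f_indep f_pole).
Qed.
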